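(* Let $M=\mathbb{H}^{n+1}/\Gamma$ be a closed hyperbolic manifold with injectivity radius $i_M$, let $o\in M$, fix $0<\varepsilon_0<i_M/2$, let $v\in SM_o$ (the unit tangent sphere at $o$), and let $\varphi:(1,\infty)\to(\varepsilon_0,\infty)$ be an increasing invertible function. (1) If the ray $\gamma_v$ is $\varphi$-aperiodic with parameters $\varepsilon_0$ and $l_0=0$, then $$v\in\bigcap_{\alpha\text{ a closed geodesic in }M}\mathbf{Bounded}_\alpha\big(|\alpha|+\varphi^{-1}(|\alpha|)\big).\qquad( * )$$ (2) Conversely, if $v$ satisfies $( * )$ and $i_M\ge2\delta_0$, where $\delta_0=\log(1+\sqrt2)$, then there exist a constant $c_0=c_0(M,\varepsilon_0)>0$, a length $l_0>2c_0+2\varepsilon_0+1$ and a shift $s_0>\varepsilon_0$ such that for all times $t_0\ge0$, all shifts $s\ge s_0$ and all lengths $l\ge l_0$, $$d_l(\phi^{t_0}v,\phi^{t_0+s}v)\le\varepsilon_0\ \Longrightarrow\ s\ge\tilde\varphi(l),\qquad\text{where }\ \tilde\varphi(l)=\varphi(l-2c_0-2\varepsilon_0)-\varepsilon_0 .$$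
   Context: $\mathbb{H}^{n+1}$ is real hyperbolic space of dimension $n+1$ (curvature $-1$), $\Gamma$ is a torsion-free cocompact lattice in its isometry group, $\phi^t$ is the geodesic flow on the unit tangent bundle $SM$, $\pi:SM\to M$ is the footpoint projection, $d_M$ (also written $d$) is the Riemannian distance on $M$, and $\gamma_v(t)=\pi\phi^t(v)$. For real $l\ge0$ put $d_l(v,w)=\max_{0\le t\le l}d_M(\pi\phi^tv,\pi\phi^tw)$. The ray $\gamma_v$ is $\varphi$-aperiodic with parameters $\varepsilon_0,l_0$ if for all times $t\ge0$, all shifts $s>\varepsilon_0$ and all lengths $l\ge l_0$ (in the domain of $\varphi$): $d_l(\phi^tv,\phi^{t+s}v)\le\varepsilon_0\Rightarrow s\ge\varphi(l)$. For a closed geodesic $\alpha:\mathbb{R}\to M$ (unit speed, of length $|\alpha|$) let $v_\alpha=\dot\alpha(0)$. The penetration length of $\gamma_v$ at time $t_0\ge0$ in the neighborhood of $\alpha$ is $\mathfrak{p}_\alpha(v,t_0)=0$ if $d(\gamma_v(t_0),\alpha)>\varepsilon_0/2$, and otherwise $$\mathfrak{p}_\alpha(v,t_0)=\sup\{L\ge0: d_L(\phi^{t_0}v,\phi^tv_\alpha)\le\varepsilon_0/2\text{ for some }t\in[0,|\alpha|]\}\in[0,\infty].$$ For $L<\infty$, $\mathbf{Bounded}_\alpha(L)=\{v\in SM_o:\mathfrak{p}_\alpha(v,t_0)\le L\text{ for all }t_0\ge0\}$. *)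

(* Defs.v *)
From HB Require Import structures.
From mathcomp Require Import all_boot all_order all_algebra.
From mathcomp Require Import all_classical all_reals all_analysis.
From mathcomp Require Import ring lra.

Set Implicit Arguments.
Unset Strict Implicit.
Unset Printing Implicit Defensive.

Import Order.TTheory GRing.Theory Num.Theory.
Import numFieldNormedType.Exports.

Local Open Scope classical_set_scope.
Local Open Scope ring_scope.

Section HyperbolicFunctions.
Context {R : realType}.
Implicit Types t : R.

Definition cosh t : R := (expR t + expR (- t)) / 2.
Definition sinh t : R := (expR t - expR (- t)) / 2.
Definition arcosh (x : R) : R := ln (x + Num.sqrt (x ^+ 2 - 1)).

Lemma cosh2_sinh2 t : cosh t ^+ 2 - sinh t ^+ 2 = 1.
Proof.
have : expR t * expR (- t) = 1 by rewrite -expRD subrr expR0.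
rewrite /cosh /sinh; move: (expR t) (expR (- t)) => a b ab.
have -> : ((a + b) / 2) ^+ 2 - ((a - b) / 2) ^+ 2 = a * b by field.
exact: ab.
Qed.

Lemma sinh_lt_cosh t : - cosh t < sinh t < cosh t.
Proof.
have := expR_gt0 t; have := expR_gt0 (- t); rewrite /cosh /sinh => ? ?.
by apply/andP; split; lra.
Qed.

End HyperbolicFunctions.

(* The hyperboloid model of H^d in R^(d+1), with row vectors; coordinate 0 is
   the time coordinate. *)
Section Hyperboloid.
Context {R : realType} {d : nat}.
Local Notation vec := 'rV[R]_d.+1.
Implicit Types x y z : vec.

Definition lform x y : R :=
  - (x 0 0 * y 0 0) + \sum_(i < d) x 0 (lift ord0 i) * y 0 (lift ord0 i).

Lemma lformC x y : lform x y = lform y x.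
Proof.
by rewrite /lform mulrC; congr (_ + _); apply: eq_bigr => i _; rewrite mulrC.
Qed.

Lemma lform_linl (a b : R) x y z :
  lform (a *: x + b *: y) z = a * lform x z + b * lform y z.
Proof.
rewrite /lform !mxE !mulrDr !mulr_sumr.
under eq_bigr do rewrite !mxE mulrDl -!mulrA.
by rewrite big_split /=; ring.
Qed.

Lemma lform_linr (a b : R) x y z :
  lform z (a *: x + b *: y) = a * lform z x + b * lform z y.
Proof. by rewrite lformC lform_linl !(lformC z). Qed.

Definition on_hyperboloid x := (lform x x == -1) && (0 < x 0 0).

Definition unit_tangent x u :=
  [&& on_hyperboloid x, lform x u == 0 & lform u u == 1].

Lemma unit_tangent_time x u : unit_tangent x u -> - x 0 0 <= u 0 0 <= x 0 0.
Proof.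
case/and3P=> /andP[/eqP xx x0] /eqP xu /eqP uu.
have : 0 <= \sum_(i < d)
    (x 0 0 * u 0 (lift ord0 i) - u 0 0 * x 0 (lift ord0 i)) ^+ 2.
  by apply: sumr_ge0 => i _; exact: sqr_ge0.
have -> : \sum_(i < d)
    (x 0 0 * u 0 (lift ord0 i) - u 0 0 * x 0 (lift ord0 i)) ^+ 2 =
    x 0 0 ^+ 2 * (lform u u + u 0 0 * u 0 0)
    - 2 * x 0 0 * u 0 0 * (lform x u + x 0 0 * u 0 0)
    + u 0 0 ^+ 2 * (lform x x + x 0 0 * x 0 0).
  have e (a s : R) : - a + s + a = s by ring.
  rewrite /lform !e !mulr_sumr.
  rewrite -sumrN -!big_split /=; apply: eq_bigr => i _; ring.
rewrite xx xu uu => h.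
have {}h : u 0 0 ^+ 2 <= x 0 0 ^+ 2 by nra.
by rewrite -ler_norml -(gtr0_norm x0) -ler_sqr ?nnegrE// !real_normK ?num_real.
Qed.

Lemma unit_tangent_flow x u t : unit_tangent x u ->
  unit_tangent (cosh t *: x + sinh t *: u) (sinh t *: x + cosh t *: u).
Proof.
move=> xu; have := unit_tangent_time xu.
case/and3P: xu => /andP[/eqP xx x0] /eqP xu /eqP uu /andP[h1 h2].
have ux : lform u x = 0 by rewrite lformC.
have cs := cosh2_sinh2 t; have /andP[s1 s2] := sinh_lt_cosh t.
apply/and3P; split; [apply/andP; split| |].
- by apply/eqP; rewrite !(lform_linl, lform_linr) xx ux xu uu; lra.
- rewrite !mxE; move: x0 h1 h2 s1 s2 {cs}.
  move: (x 0 0) (u 0 0) (cosh t) (sinh t) => a b c s a0 h1 h2 s1 s2.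
  suff : 0 < (c + s) * (a + b) + (c - s) * (a - b) by nra.
  have [b0|b0] := ltP 0 b; [apply: ltr_wpDr|apply: ltr_wpDl].
  - by apply: mulr_ge0; lra.
  - by apply: mulr_gt0; lra.
  - by apply: mulr_ge0; lra.
  - by apply: mulr_gt0; lra.
- by apply/eqP; rewrite !(lform_linl, lform_linr) xx ux xu uu; ring.
- by apply/eqP; rewrite !(lform_linl, lform_linr) xx ux xu uu; lra.
Qed.

End Hyperboloid.

Record hyp (R : realType) (d : nat) := Hyp {
  hyp_val :> 'rV[R]_d.+1;
  hypP : on_hyperboloid hyp_val }.

HB.instance Definition _ R d := [isSub for @hyp_val R d].
HB.instance Definition _ R d := [Choice of hyp R d by <:].
HB.instance Definition _ R d :=
  Topological.copy (hyp R d) (initial_topology (@hyp_val R d)).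

Definition hyp_dist (R : realType) (d : nat) (x y : hyp R d) : R :=
  arcosh (- lform x y).

(* The first component is the footpoint. *)
Record unithyp (R : realType) (d : nat) := UnitHyp {
  unithyp_val :> 'rV[R]_d.+1 * 'rV[R]_d.+1;
  unithypP : unit_tangent unithyp_val.1 unithyp_val.2 }.

HB.instance Definition _ R d := [isSub for @unithyp_val R d].
HB.instance Definition _ R d := [Choice of unithyp R d by <:].

Section UnitTangentBundle.
Context {R : realType} {d : nat}.

Definition hyp_foot (p : unithyp R d) : hyp R d :=
  let: UnitHyp p pP := p in Hyp (proj1 (andP pP)).

Definition hyp_flow (t : R) (p : unithyp R d) : unithyp R d :=
  UnitHyp (unithyp_val := (cosh t *: p.1 + sinh t *: p.2,
                           sinh t *: p.1 + cosh t *: p.2))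
          (unit_tangent_flow t (unithypP p)).

(* The isometry group of H^d is O^+(1,d): the linear automorphisms preserving the
   Lorentz form and the upper sheet; matrices act on row vectors from the
   right. *)
Definition hyp_isometry : set 'M[R]_d.+1 :=
  [set g | [/\ g \is a GRing.unit,
             (forall x y, lform (x *m g) (y *m g) = lform x y) &
             (forall x, on_hyperboloid x -> on_hyperboloid (x *m g))]].

End UnitTangentBundle.

Record isom_group (R : realType) (d : nat) := IsomGroup {
  isom_set :> set 'M[R]_d.+1;
  isom_group_sub : isom_set `<=` hyp_isometry;
  isom_group1 : isom_set 1;
  isom_groupM : forall g h, isom_set g -> isom_set h -> isom_set (g * h);
  isom_groupV : forall g, isom_set g -> isom_set g^-1 }.

Lemma isom_group_unit (R : realType) (d : nat) (G : isom_group R d) g :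
  isom_set G g -> g \is a GRing.unit.
Proof. by move=> /isom_group_sub[]. Qed.

Section Quotient.
Context {R : realType} {d : nat} (G : isom_group R d).
Local Open Scope quotient_scope.

Definition hyp_rel (x y : hyp R d) : bool :=
  `[< exists2 g, isom_set G g & y = x *m g :> 'rV_d.+1 >].

Lemma hyp_rel_refl : reflexive hyp_rel.
Proof.
by move=> x; apply/asboolP; exists 1; rewrite ?mulmx1//; exact: isom_group1.
Qed.

Lemma hyp_rel_sym : symmetric hyp_rel.
Proof.
suff h x y : hyp_rel x y -> hyp_rel y x by move=> x y; apply/idP/idP; exact: h.
move=> /asboolP[g Gg yE]; apply/asboolP; exists g^-1; first exact: isom_groupV.
by rewrite yE -mulmxA mulmxV ?mulmx1//; exact: (isom_group_unit Gg).
Qed.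

Lemma hyp_rel_trans : transitive hyp_rel.
Proof.
move=> y x z /asboolP[g Gg yE] /asboolP[h Gh zE]; apply/asboolP.
by exists (g * h); [exact: isom_groupM|rewrite zE yE mulmxA].
Qed.

Canonical hyp_rel_equiv :=
  EquivRel hyp_rel hyp_rel_refl hyp_rel_sym hyp_rel_trans.

Definition unithyp_rel (p q : unithyp R d) : bool :=
  `[< exists2 g, isom_set G g & (q.1 = p.1 *m g /\ q.2 = p.2 *m g) >].

Lemma unithyp_rel_refl : reflexive unithyp_rel.
Proof.
by move=> x; apply/asboolP; exists 1; rewrite ?mulmx1//; exact: isom_group1.
Qed.

Lemma unithyp_rel_sym : symmetric unithyp_rel.
Proof.
suff h x y : unithyp_rel x y -> unithyp_rel y x.
  by move=> x y; apply/idP/idP; exact: h.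
move=> /asboolP[g Gg [y1 y2]]; apply/asboolP; exists g^-1.
  exact: isom_groupV.
by rewrite y1 y2 -!mulmxA mulmxV ?mulmx1//; exact: (isom_group_unit Gg).
Qed.

Lemma unithyp_rel_trans : transitive unithyp_rel.
Proof.
move=> y x z /asboolP[g Gg [y1 y2]] /asboolP[h Gh [z1 z2]]; apply/asboolP.
by exists (g * h); [exact: isom_groupM|rewrite z1 z2 y1 y2 !mulmxA].
Qed.

Canonical unithyp_rel_equiv :=
  EquivRel unithyp_rel unithyp_rel_refl unithyp_rel_sym unithyp_rel_trans.

(* M = H^d / G and its unit tangent bundle SM. *)
Definition qman := {eq_quot hyp_rel_equiv}.
HB.instance Definition _ := Quotient.on qman.
HB.instance Definition _ := Topological.copy qman (quotient_topology qman).

Definition unitM := {eq_quot unithyp_rel_equiv}.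
HB.instance Definition _ := Quotient.on unitM.

Definition foot (v : unitM) : qman := \pi_qman (hyp_foot (repr v)).
Definition flow (t : R) (v : unitM) : unitM := \pi_unitM (hyp_flow t (repr v)).

Lemma unithyp_rel_repr (p : unithyp R d) : unithyp_rel p (repr (\pi_unitM p)).
Proof. by apply/(@eqmodP _ unithyp_rel_equiv); rewrite reprK. Qed.

Lemma foot_pi (p : unithyp R d) : foot (\pi_unitM p) = \pi_qman (hyp_foot p).
Proof.
apply/(@eqmodP _ hyp_rel_equiv) => /=; rewrite hyp_rel_sym.
have /asboolP[g Gg [h1 _]] := unithyp_rel_repr p; apply/asboolP; exists g => //.
by move: h1; case: (repr _) => q /= ? ->; case: p.
Qed.

Lemma flow_pi t (p : unithyp R d) :
  flow t (\pi_unitM p) = \pi_unitM (hyp_flow t p).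
Proof.
apply/(@eqmodP _ unithyp_rel_equiv) => /=; rewrite unithyp_rel_sym.
have /asboolP[g Gg [h1 h2]] := unithyp_rel_repr p.
apply/asboolP; exists g => //=.
by rewrite h1 h2 !mulmxDl -!scalemxAl.
Qed.

Definition geod (v : unitM) (t : R) : qman := foot (flow t v).

(* The quotient metric: the infimum of the distances between lifts. *)
Definition distM (p q : qman) : R :=
  inf [set r | exists x y : hyp R d,
        [/\ \pi_qman x = p, \pi_qman y = q & r = hyp_dist x y]].

Definition torsion_free :=
  forall g k, isom_set G g -> (0 < k)%N -> g ^+ k = 1 -> g = 1.

(* Discreteness in the matrix topology, and compactness of the quotient space M;
   finite covolume follows from the latter. *)
Definition cocompact_lattice :=
  isolated G = G :> set 'M[R]_d.+1 /\ compact [set: qman].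

(* For s, s' in [0, r[, s u and s' u' are arbitrary vectors of the open ball of
   radius r in T_p M, which agree iff s = s' = 0, or s = s' and u = u'. *)
Definition exp_injective (p : qman) (r : R) :=
  forall (u u' : unitM) (s s' : R), foot u = p -> foot u' = p ->
    0 <= s < r -> 0 <= s' < r -> geod u s = geod u' s' ->
    s = s' /\ (s = 0 \/ u = u').

(* exp_p is a local diffeomorphism everywhere in curvature -1, so that it is a
   diffeomorphism on a ball as soon as it is injective there. *)
Definition inj_radius_at (p : qman) : \bar R :=
  ereal_sup [set r%:E | r in [set r | 0 <= r /\ exp_injective p r]].

Definition inj_radius : \bar R := ereal_inf (range inj_radius_at).

Definition dist_upto (l : R) (v w : unitM) : R :=
  sup [set distM (geod v t) (geod w t) | t in `[0, l]].

(* D is the domain of phi; outside of D the value of phi is irrelevant. *)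
Definition aperiodic (D : set R) (phi : R -> R) (e0 l0 : R) (v : unitM) :=
  forall t s l : R, 0 <= t -> e0 < s -> l0 <= l -> D l ->
    dist_upto l (flow t v) (flow (t + s) v) <= e0 -> phi l <= s.

(* A closed geodesic alpha is given by v_alpha = alpha'(0) and its length; it
   need not be primitive. *)
Record closed_geodesic := ClosedGeodesic {
  cg_dir : unitM;
  cg_len : R;
  cg_len_gt0 : 0 < cg_len;
  cg_closed : flow cg_len cg_dir = cg_dir }.

Definition dist_geod (p : qman) (a : closed_geodesic) : R :=
  inf [set distM p q | q in range (geod (cg_dir a))].

Definition penetration (e0 : R) (a : closed_geodesic) (v : unitM) (t0 : R)
    : \bar R :=
  if e0 / 2 < dist_geod (geod v t0) a then 0%E
  else ereal_sup [set L%:E | L in [set L | 0 <= L /\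
         exists2 t, 0 <= t <= cg_len a &
           dist_upto L (flow t0 v) (flow t (cg_dir a)) <= e0 / 2]].

Definition bounded_pen (e0 : R) (o : qman) (a : closed_geodesic) (L : R)
    : set unitM :=
  [set v | foot v = o /\
     forall t0, 0 <= t0 -> (penetration e0 a v t0 <= L%:E)%E].

End Quotient.

Definition increasing_invertible (R : realType) (e0 : R) (phi : R -> R) :=
  set_bij `]1, +oo[%classic `]e0, +oo[%classic phi /\
  {in `]1, +oo[ &, {homo phi : x y / x < y}}.

Definition phi_inv (R : realType) (phi : R -> R) : R -> R :=
  'pinv_(fun=> 0) `]1, +oo[%classic phi.

Definition bounded_all (R : realType) (d : nat) (G : isom_group R d) (e0 : R)
    (o : qman G) (phi : R -> R) : set (unitM G) :=
  \bigcap_(a in [set: closed_geodesic G])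
    bounded_pen e0 o a (cg_len a + phi_inv phi (cg_len a)).

(* Main.v *)
(* Part (1): if [gamma_v] follows a closed geodesic [alpha] for longer than
   [|alpha| + L], it follows its own translate by [|alpha|] for longer than [L].

   Part (2): if [gamma_v] stays [e0]-close to its translate by [s] during a time
   [l], one isometry [g] of the lattice sends the lifted segment [0, l] close to
   the segment [s, s + l].  By cocompactness the displacement of [g] is minimal
   somewhere, and [g] has an axis there, with translation length [tau <= s + e0].
   In hyperboloid coordinates the hyperbolic sine of the distance to the axis is
   a [g]-invariant Euclidean seminorm [N], and [N (gamma t)] is comparable to
   [N (gamma (t + s))]; since [gamma t] is a combination of two null vectors with
   coefficients [e^t] and [e^-t], this bounds both coefficients and keeps [gamma]
   exponentially close to the axis away from the ends of [0, s + l].  So [gamma]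
   follows the closed geodesic of length [tau] during [s + l - 2 c0], with [c0]
   depending on [e0] only, and the bound on penetration lengths applies. *)

Require Import Defs.
From mathcomp Require Import all_boot all_order all_algebra.
From mathcomp Require Import all_classical all_reals all_analysis.
From mathcomp Require Import ring lra.

Import Order.TTheory GRing.Theory Num.Theory.
Import numFieldNormedType.Exports.

Local Open Scope classical_set_scope.
Local Open Scope ring_scope.

(** * The Lorentz form *)

Section HyperbolicFunctions.
Context {R : realType}.
Implicit Types s t x : R.

Lemma cosh0 : cosh 0 = 1 :> R.
Proof. by rewrite /cosh oppr0 expR0; field. Qed.

Lemma sinh0 : sinh 0 = 0 :> R.
Proof. by rewrite /sinh oppr0 subrr mul0r. Qed.

Lemma coshD s t : cosh (s + t) = cosh s * cosh t + sinh s * sinh t.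
Proof. by rewrite /cosh /sinh opprD !expRD; field. Qed.

Lemma sinhD s t : sinh (s + t) = sinh s * cosh t + cosh s * sinh t.
Proof. by rewrite /cosh /sinh opprD !expRD; field. Qed.

Lemma coshN t : cosh (- t) = cosh t.
Proof. by rewrite /cosh opprK addrC. Qed.

Lemma sinhN t : sinh (- t) = - sinh t.
Proof. by rewrite /sinh opprK -mulNr opprB. Qed.

Lemma cosh_add_sinh t : cosh t + sinh t = expR t.
Proof. by rewrite /cosh /sinh; field. Qed.

Lemma cosh_sub_sinh t : cosh t - sinh t = expR (- t).
Proof. by rewrite /cosh /sinh; field. Qed.

Lemma expR_mulN t : expR t * expR (- t) = 1.
Proof. by rewrite -expRD subrr expR0. Qed.

Lemma sinh_ge0 t : 0 <= t -> 0 <= sinh t.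
Proof.
move=> t0; rewrite /sinh divr_ge0// subr_ge0 ler_expR; lra.
Qed.

Lemma sinh_gt0 t : 0 < t -> 0 < sinh t.
Proof.
move=> t0; rewrite /sinh divr_gt0// subr_gt0 ltr_expR; lra.
Qed.

Lemma ltr_cosh s t : 0 <= s -> s < t -> cosh s < cosh t.
Proof.
move=> s0 st; have [u [u0 ->]] : exists u, 0 < u /\ t = s + u.
  by exists (t - s); split; lra.
rewrite coshD; have c1 : cosh u > 1.
  have := sinh_gt0 u u0; have := cosh2_sinh2 u.
  have /andP[] := sinh_lt_cosh u.
  move: (cosh u) (sinh u) => a b h1 h2 h3 h4.
  rewrite ltNge; apply/negP => a1.
  have a2 : a * a <= 1 by apply: mulr_ile1 => //; lra.
  have b2 : 0 < b * b by exact: mulr_gt0.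
  by lra.
have cs : 0 < cosh s * (cosh u - 1).
  by apply: mulr_gt0; [have /andP[] := sinh_lt_cosh s; lra|lra].
have ss : 0 <= sinh s * sinh u.
  by apply: mulr_ge0; apply: sinh_ge0 => //; exact: ltW.
by lra.
Qed.

Lemma ler_cosh s t : 0 <= s -> s <= t -> cosh s <= cosh t.
Proof.
by move=> s0; rewrite le_eqVlt => /predU1P[->//|/(ltr_cosh _ _ s0)/ltW].
Qed.

Lemma cosh_ge1 t : 1 <= cosh t.
Proof.
rewrite -cosh0; have [t0|t0] := leP 0 t; first exact: ler_cosh.
by rewrite -(coshN t) ler_cosh// oppr_ge0 ltW.
Qed.

Lemma arcosh_ge0 x : 1 <= x -> 0 <= arcosh x.
Proof. by move=> x1; rewrite ln_ge0// (le_trans x1)// lerDl sqrtr_ge0. Qed.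

Lemma cosh_arcosh x : 1 <= x -> cosh (arcosh x) = x.
Proof.
move=> x1; have r0 := sqrtr_ge0 (x ^+ 2 - 1).
have r2 : Num.sqrt (x ^+ 2 - 1) ^+ 2 = x ^+ 2 - 1.
  by rewrite sqr_sqrtr// subr_ge0 exprn_ege1.
rewrite /cosh /arcosh expRN lnK; last by rewrite posrE; lra.
have n0 : x + Num.sqrt (x ^+ 2 - 1) != 0 by apply: lt0r_neq0; lra.
apply: (mulIf n0); rewrite mulrAC mulrDl mulVf//.
by move: (Num.sqrt _) r2 => r r2; lra.
Qed.

End HyperbolicFunctions.

(** Cauchy-Schwarz with abstract coefficients, so that it serves both the Euclidean spatial part and
    the Lorentz form on the orthogonal complement of a timelike vector. *)
Lemma discriminant_le {R : realFieldType} (a b c : R) : 0 <= a -> 0 <= c ->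
  (forall s t, 0 <= s ^+ 2 * a + 2 * (s * t) * b + t ^+ 2 * c) ->
  b ^+ 2 <= a * c.
Proof.
move=> a0 c0 h; move: c0; rewrite le_eqVlt => /predU1P[c0|c0].
  (* For [c = 0] the form takes the value [- (a + 2) * b ^+ 2] at this point, which forces
     [b = 0]. *)
  have := h b (- (a + 1)); have := mulr_ge0 a0 (sqr_ge0 b); rewrite -c0.
  by have := sqr_ge0 b; lra.
have := h c (- b); have -> : c ^+ 2 * a + 2 * (c * - b) * b + (- b) ^+ 2 * c =
  c * (a * c - b ^+ 2) by ring.
by rewrite pmulr_rge0// subr_ge0.
Qed.

(** * Causal structure of the Lorentz form and the triangle inequality *)

Section LorentzForm.
Context {R : realType} {d : nat}.
Local Notation vec := 'rV[R]_d.+1.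
Implicit Types x y z u : vec.

Definition sform x y : R :=
  \sum_(i < d) x 0 (lift ord0 i) * y 0 (lift ord0 i).

Lemma lformE x y : lform x y = sform x y - x 0 0 * y 0 0.
Proof. by rewrite /lform addrC. Qed.

Lemma sform_ge0 x : 0 <= sform x x.
Proof. by apply: sumr_ge0 => i _; rewrite -expr2 sqr_ge0. Qed.

Lemma sform_CS x y : sform x y ^+ 2 <= sform x x * sform y y.
Proof.
apply: discriminant_le (sform_ge0 x) (sform_ge0 y) _ => s t.
have -> : s ^+ 2 * sform x x + 2 * (s * t) * sform x y + t ^+ 2 * sform y y
  = sform (s *: x + t *: y) (s *: x + t *: y).
  rewrite /sform !mulr_sumr -!big_split; apply: eq_bigr => i _ /=.
  by rewrite !mxE; ring.
exact: sform_ge0.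
Qed.

Lemma sqr_coord_le_sform x i : x 0 (lift ord0 i) ^+ 2 <= sform x x.
Proof.
rewrite /sform (bigD1 i)//= expr2 lerDl sumr_ge0// => k _.
by rewrite -expr2 sqr_ge0.
Qed.

Lemma sform_eq0 x : sform x x = 0 -> forall i, x 0 (lift ord0 i) = 0.
Proof.
move/eqP; rewrite psumr_eq0 => [|i _]; last by rewrite -expr2 sqr_ge0.
by move=> /allP h i; have := h i (mem_index_enum i); rewrite -expr2 sqrf_eq0 => /eqP.
Qed.

Lemma hyperboloidP x : on_hyperboloid x <-> lform x x = -1 /\ 0 < x 0 0.
Proof.
by split=> [/andP[/eqP]|[xx x0]] //; rewrite /on_hyperboloid xx eqxx.
Qed.

(** In the closed future cone the spatial product is dominated by the product of the time
    coordinates. *)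
Lemma causal_le0 x y : 0 <= x 0 0 -> 0 <= y 0 0 -> lform x x <= 0 ->
  lform y y <= 0 -> lform x y <= 0.
Proof.
rewrite !lformE => x0 y0 xx yy.
have sxy : sform x y ^+ 2 <= (x 0 0 * y 0 0) ^+ 2.
  apply: (le_trans (sform_CS x y)); rewrite exprMn.
  by apply: ler_pM; rewrite ?sform_ge0//; lra.
have xy0 : 0 <= x 0 0 * y 0 0 by exact: mulr_ge0.
have : `|sform x y| <= x 0 0 * y 0 0.
  by rewrite -ler_sqr ?nnegrE// real_normK ?num_real.
by rewrite ler_norml => /andP[_]; lra.
Qed.

(** Orthogonality turns the spatial Cauchy-Schwarz inequality into
    [(a * b) ^+ 2 <= (a ^+ 2 - 1) * s], where [a], [b] are the time coordinates of [x], [z] and [s]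
    is the spatial square of [z]. *)
Lemma spacelike_ge0 x z : on_hyperboloid x -> lform x z = 0 -> 0 <= lform z z.
Proof.
move=> /hyperboloidP[xx x0]; move: xx; rewrite !lformE => xx xz.
have := sform_CS x z; have := sform_ge0 z.
have -> : sform x z = x 0 0 * z 0 0 by lra.
have -> : sform x x = x 0 0 * x 0 0 - 1 by lra.
move: (sform z z) (z 0 0) (x 0 0) x0 => s b a a0 h1 h2.
have : 0 <= a ^+ 2 * (s - b * b) by lra.
by rewrite pmulr_rge0// exprn_gt0.
Qed.

Lemma spacelike_eq0 x z : on_hyperboloid x -> lform x z = 0 -> lform z z <= 0 ->
  z = 0.
Proof.
move=> /hyperboloidP[xx x0]; move: xx; rewrite !lformE => xx xz zz.
have CS := sform_CS x z; have sz := sform_ge0 z; move: CS sz.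
have -> : sform x z = x 0 0 * z 0 0 by lra.
have -> : sform x x = x 0 0 * x 0 0 - 1 by lra.
move=> CS sz; have s0 : sform z z = 0.
  move: (sform z z) (z 0 0) (x 0 0) x0 zz CS sz {xx xz} => s a b.
  move=> b0 zz CS sz; have : b ^+ 2 * s <= b ^+ 2 * (a * a).
    by rewrite ler_pM2l ?exprn_gt0//; lra.
  by lra.
have z00 : z 0 0 = 0.
  move: CS; rewrite s0 mulr0 exprMn => h.
  have {}h : (x 0 0 * z 0 0) ^+ 2 <= 0 by rewrite exprMn.
  have : (x 0 0 * z 0 0) ^+ 2 = 0 by apply/eqP; rewrite eq_le h sqr_ge0.
  by move/eqP; rewrite sqrf_eq0 mulf_eq0 gt_eqF//= => /eqP.
apply/rowP => i; rewrite mxE; case: (unliftP ord0 i) => [j ->|->//].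
exact: sform_eq0.
Qed.

(** Reverse Cauchy-Schwarz: the component of [y] orthogonal to [x] has square [lform x y ^+ 2 - 1],
    which is nonnegative, and the time orientation fixes the sign. *)
Lemma hyperboloid_lform x y : on_hyperboloid x -> on_hyperboloid y ->
  lform x y <= -1.
Proof.
move=> xH yH; have /hyperboloidP[xx x0] := xH; have /hyperboloidP[yy y0] := yH.
have xy : lform x y <= 0 by apply: causal_le0; lra.
have := spacelike_ge0 x (1 *: y + lform x y *: x) xH.
rewrite !(lform_linl, lform_linr) (lformC y x) xx yy => h.
have xy1 : 1 <= lform x y ^+ 2 by have := h ltac:(ring); lra.
rewrite leNgt; apply/negP => xy0.
have : 0 < (lform x y + 1) * (1 - lform x y) by apply: mulr_gt0; lra.
by lra.
Qed.

Lemma hyperboloid_lform_eq x y : on_hyperboloid x -> on_hyperboloid y ->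
  lform x y = -1 -> x = y.
Proof.
move=> xH yH; have /hyperboloidP[xx x0] := xH; have /hyperboloidP[yy y0] := yH.
move=> xy; have : 1 *: x + (- 1) *: y = 0.
  apply: (spacelike_eq0 x _ xH); by rewrite !(lform_linl, lform_linr) ?(lformC y x) xx ?yy xy; lra.
by rewrite scaleN1r scale1r => /eqP; rewrite subr_eq0 => /eqP.
Qed.

Lemma spacelike_CS x y z : on_hyperboloid x -> lform x y = 0 ->
  lform x z = 0 -> lform y z ^+ 2 <= lform y y * lform z z.
Proof.
move=> xH xy xz; apply: discriminant_le; try exact: (spacelike_ge0 x).
move=> s t; have := spacelike_ge0 x (s *: y + t *: z) xH.
rewrite !(lform_linl, lform_linr) (lformC z y) xy xz => h.
by have := h ltac:(ring); lra.
Qed.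

(** The components of [x] and [z] orthogonal to [y] have lengths [sinh a] and [sinh b] and product
    [lform x z + cosh a * cosh b]; Cauchy-Schwarz and the addition formula conclude. *)
Lemma lform_triangle x y z a b : on_hyperboloid x -> on_hyperboloid y ->
  on_hyperboloid z -> 0 <= a -> 0 <= b ->
  - lform x y = cosh a -> - lform y z = cosh b -> - lform x z <= cosh (a + b).
Proof.
move=> xH yH zH a0 b0 xy yz.
have /hyperboloidP[xx x0] := xH; have /hyperboloidP[yy y0] := yH.
have /hyperboloidP[zz z0] := zH.
have := spacelike_CS y (1 *: x + lform x y *: y) (1 *: z + lform y z *: y) yH.
rewrite !(lform_linl, lform_linr) (lformC y x) (lformC z y) xx yy zz.
have -> : lform x y = - cosh a by lra.
have -> : lform y z = - cosh b by lra.
move=> /(_ ltac:(ring) ltac:(ring)).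
have := cosh2_sinh2 a; have := cosh2_sinh2 b.
have := sinh_ge0 a a0; have := sinh_ge0 b b0; rewrite coshD.
move: (cosh a) (cosh b) (sinh a) (sinh b) (lform x z) => ca cb sa sb w.
move=> sb0 sa0 hb ha h.
have hh : (w + ca * cb) ^+ 2 <= (sa * sb) ^+ 2.
  have -> : (sa * sb) ^+ 2 = (ca ^+ 2 - 1) * (cb ^+ 2 - 1).
    by rewrite exprMn; congr (_ * _); lra.
  by lra.
have ss : 0 <= sa * sb by exact: mulr_ge0.
have : `|w + ca * cb| <= sa * sb.
  by rewrite -ler_sqr ?nnegrE// real_normK ?num_real.
by rewrite ler_norml => /andP[]; lra.
Qed.

End LorentzForm.

Section LformLinear.
Context {R : realType} {d : nat}.
Local Notation vec := 'rV[R]_d.+1.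
Implicit Types x y z : vec.

Lemma lformDl x y z : lform (x + y) z = lform x z + lform y z.
Proof. by rewrite -[x]scale1r -[y]scale1r lform_linl !scale1r !mul1r. Qed.

Lemma lformZl a x z : lform (a *: x) z = a * lform x z.
Proof. by rewrite -[_ *: _]addr0 -(scale0r x) lform_linl mul0r addr0. Qed.

Lemma lformNl x z : lform (- x) z = - lform x z.
Proof. by rewrite -scaleN1r lformZl mulN1r. Qed.

Lemma lformDr x y z : lform z (x + y) = lform z x + lform z y.
Proof. by rewrite lformC lformDl !(lformC z). Qed.

Lemma lformNr x z : lform z (- x) = - lform z x.
Proof. by rewrite lformC lformNl lformC. Qed.

Lemma lformZr a x z : lform z (a *: x) = a * lform z x.
Proof. by rewrite lformC lformZl lformC. Qed.

Definition lformL :=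
  (lformDl, lformNl, lformZl, lformDr, lformNr, lformZr).

End LformLinear.

(** * Unit tangent vectors and the geodesic between two points *)

Section UnitTangent.
Context {R : realType} {d : nat}.
Local Notation vec := 'rV[R]_d.+1.
Implicit Types x y z u w : vec.

Lemma unit_tangentP x u : unit_tangent x u <->
  [/\ on_hyperboloid x, lform x u = 0 & lform u u = 1].
Proof.
by split=> [/and3P[? /eqP ? /eqP ?]|[? ? ?]]; [split|apply/and3P; split=> //; apply/eqP].
Qed.

Lemma unit_tangentN x u : unit_tangent x u -> unit_tangent x (- u).
Proof.
move=> /unit_tangentP[xH xu uu]; apply/unit_tangentP.
by rewrite -scaleN1r !lformL xu uu; split=> //; ring.
Qed.

(** [x + u] is a future null vector, representing the endpoint at infinity of the geodesic with
    direction [u]; so is [y + w]. *)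
Lemma unit_tangent_lform_le0 x u y w : unit_tangent x u -> unit_tangent y w ->
  lform (x + u) (y + w) <= 0.
Proof.
move=> xu yw; have /andP[xu1 _] := unit_tangent_time xu.
have /andP[yw1 _] := unit_tangent_time yw.
move: xu yw => /unit_tangentP[/hyperboloidP[xx _] xu uu].
move=> /unit_tangentP[/hyperboloidP[yy _] yw ww].
apply: causal_le0; rewrite ?mxE; try lra.
- by rewrite !lformL (lformC u x) xx xu uu; lra.
- by rewrite !lformL (lformC w y) yy yw ww; lra.
Qed.

(** [r] is the distance and [u] the normalised component of [y] orthogonal to [x]. When
    [lform x y = -1] the points coincide and no direction is singled out. *)
Lemma hyperboloid_geodesic x y : on_hyperboloid x -> on_hyperboloid y ->
  lform x y != -1 -> exists r u, [/\ 0 < r, unit_tangent x u,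
    - lform x y = cosh r & y = cosh r *: x + sinh r *: u].
Proof.
move=> xH yH xy; have h := hyperboloid_lform _ _ xH yH.
have h1 : 1 <= - lform x y by lra.
have cr := cosh_arcosh _ h1; have r0 := arcosh_ge0 _ h1.
have {}r0 : 0 < arcosh (- lform x y).
  rewrite lt_neqAle r0 andbT; apply: contraNneq xy => r0'.
  by move: cr; rewrite -r0' cosh0 => e; apply/eqP; lra.
move: (arcosh _) cr r0 => r cr r0.
have s0 := sinh_gt0 _ r0; have cs := cosh2_sinh2 r.
exists r, ((sinh r)^-1 *: (y - cosh r *: x)); split => //; last first.
  rewrite scalerA divff ?gt_eqF// scale1r addrCA subrr addr0 //.
have /hyperboloidP[xx _] := xH; have /hyperboloidP[yy _] := yH.
apply/unit_tangentP; split => //; rewrite !lformL ?(lformC y x) ?xx ?yy.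
  by rewrite cr; ring.
have -> : lform x y = - cosh r by lra.
have sn : sinh r != 0 by rewrite gt_eqF.
have c2 : cosh r ^+ 2 = sinh r ^+ 2 + 1 by lra.
apply: (@mulfI _ (sinh r ^+ 2)); first by rewrite sqrf_eq0.
rewrite [LHS](_ : _ = cosh r ^+ 2 - 1); last by field.
by rewrite c2; ring.
Qed.

End UnitTangent.

(** * Geodesics near the axis of a translation *)

Section AxisDistance.
Context {R : realType} {d : nat}.
Local Notation vec := 'rV[R]_d.+1.
Implicit Types x y z u w : vec.

Variables y w : vec.
Hypothesis yw : unit_tangent y w.

Let yH : on_hyperboloid y. Proof. by case/unit_tangentP: yw. Qed.
Let yy : lform y y = -1. Proof. by case/hyperboloidP: yH. Qed.
Let yw0 : lform y w = 0. Proof. by case/unit_tangentP: yw. Qed.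
Let wy0 : lform w y = 0. Proof. by rewrite lformC. Qed.
Let ww : lform w w = 1. Proof. by case/unit_tangentP: yw. Qed.

(** The Lorentz form of the components orthogonal to the plane spanned by [y] and [w], which cuts
    the hyperboloid in the axis. *)
Definition axis_form z z' : R :=
  lform z z' + lform z y * lform z' y - lform z w * lform z' w.

Let proj z := z + lform z y *: y - lform z w *: w.

Let proj_orth z : lform y (proj z) = 0.
Proof. by rewrite /proj !lformL yy yw0 (lformC y z); ring. Qed.

Let proj_form z z' : lform (proj z) (proj z') = axis_form z z'.
Proof.
rewrite /proj /axis_form !lformL yy yw0 wy0 ww (lformC y z') (lformC w z').
by ring.
Qed.

Lemma axis_form_ge0 z : 0 <= axis_form z z.
Proof. by rewrite -proj_form; exact: (spacelike_ge0 _ _ yH). Qed.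

(* For a point [z] of the hyperboloid this is the hyperbolic sine of its
   distance to the axis through [y] in the direction [w]. *)
Definition axis_norm z : R := Num.sqrt (axis_form z z).

Lemma axis_norm_ge0 z : 0 <= axis_norm z.
Proof. exact: sqrtr_ge0. Qed.

Lemma sqr_axis_norm z : axis_norm z ^+ 2 = axis_form z z.
Proof. by rewrite sqr_sqrtr// axis_form_ge0. Qed.

Lemma axis_form_CS z z' : `|axis_form z z'| <= axis_norm z * axis_norm z'.
Proof.
rewrite -ler_sqr ?nnegrE ?mulr_ge0 ?axis_norm_ge0// real_normK ?num_real//.
rewrite exprMn !sqr_axis_norm -!proj_form.
exact: (spacelike_CS y).
Qed.

Lemma axis_norm_lin a b z z' :
  axis_norm (a *: z + b *: z') <= `|a| * axis_norm z + `|b| * axis_norm z'.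
Proof.
rewrite -ler_sqr ?nnegrE ?axis_norm_ge0 ?addr_ge0 ?mulr_ge0 ?axis_norm_ge0//.
rewrite sqr_axis_norm sqrrD !exprMn !real_normK ?num_real// !sqr_axis_norm.
have -> : axis_form (a *: z + b *: z') (a *: z + b *: z') =
  a ^+ 2 * axis_form z z + (a * b) * axis_form z z' *+ 2
  + b ^+ 2 * axis_form z' z'.
  by rewrite /axis_form !lformL (lformC z' z); ring.
rewrite lerD2r lerD2l lerMn2r /=.
apply: (le_trans (ler_norm _)); rewrite normrM normrM.
have -> : `|a| * axis_norm z * (`|b| * axis_norm z') =
  `|a| * `|b| * (axis_norm z * axis_norm z') by ring.
by rewrite ler_wpM2l ?mulr_ge0// axis_form_CS.
Qed.

Lemma axis_normZ a z : axis_norm (a *: z) = `|a| * axis_norm z.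
Proof.
rewrite /axis_norm (_ : axis_form _ _ = a ^+ 2 * axis_form z z); last first.
  by rewrite /axis_form !lformL; ring.
by rewrite sqrtrM ?sqr_ge0// sqrtr_sqr.
Qed.

(** The second term pairs [z] with the two endpoints [y - w] and [y + w] of the axis; for a null
    vector [z] only this product remains. *)
Lemma axis_formE z : axis_form z z = lform z z + lform z (y - w) * lform z (y + w).
Proof. by rewrite /axis_form !lformL; ring. Qed.

(** Along the geodesic [x' = cosh r *: x + sinh r *: u] the seminorm grows at most by the factor
    [expR r], once the seminorm of the direction [u] is bounded by that of [x] plus 2. *)
Lemma axis_norm_near e x x' : 0 <= e -> on_hyperboloid x ->
  on_hyperboloid x' -> - lform x x' <= cosh e ->
  axis_norm x' <= expR e * (axis_norm x + 2).
Proof.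
move=> e0 xH xH' xx'; have n0 := axis_norm_ge0 x.
have [xe|xne] := eqVneq (lform x x') (-1).
  rewrite -(hyperboloid_lform_eq _ _ xH xH' xe).
  have : 1 <= expR e by rewrite -expR0 ler_expR.
  by move: (expR e) => E E1; have := ler_wpM2r n0 E1; lra.
have [r [u [r0 xu re ->]]] := hyperboloid_geodesic _ _ xH xH' xne.
have r_le_e : r <= e.
  rewrite leNgt; apply/negP => er; have := ltr_cosh _ _ e0 er; lra.
have nu : axis_norm u <= axis_norm x + 2.
  rewrite -ler_sqr ?nnegrE ?axis_norm_ge0//; last by lra.
  have /unit_tangentP[_ _ uu] := xu.
  rewrite sqr_axis_norm axis_formE uu.
  (* By [axis_formE] this compares the products of pairings of [x] and of [u] with the two endpoints
     of the axis. The signs of the pairings of the null vectors [x + u], [x - u] with [y + w],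
     [y - w] give it. *)
  have : 0 <= axis_norm x ^+ 2 + 1 - lform u (y - w) * lform u (y + w).
    have /hyperboloidP[xx _] := xH.
    rewrite sqr_axis_norm axis_formE xx.
    have xu' := unit_tangentN _ _ xu; have yw' := unit_tangentN _ _ yw.
    have := unit_tangent_lform_le0 _ _ _ _ xu yw.
    have := unit_tangent_lform_le0 _ _ _ _ xu yw'.
    have := unit_tangent_lform_le0 _ _ _ _ xu' yw.
    have := unit_tangent_lform_le0 _ _ _ _ xu' yw'.
    rewrite !(lformDl x) !lformNl.
    move: (lform x _) (lform u _) (lform x _) (lform u _) => a b a' b'.
    move=> h1 h2 h3 h4.
    have m1 : 0 <= (a + b) * (a' - b') by apply: mulr_le0; lra.
    have m2 : 0 <= (a - b) * (a' + b') by apply: mulr_le0; lra.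
    by lra.
  by lra.
apply: (le_trans (axis_norm_lin _ _ _ _)).
have s0 := sinh_gt0 _ r0; have c1 := cosh_ge1 r.
rewrite !ger0_norm; [|lra..].
have h1 : cosh r * axis_norm x <= cosh r * (axis_norm x + 2).
  by rewrite ler_wpM2l//; lra.
have h2 : sinh r * axis_norm u <= sinh r * (axis_norm x + 2).
  by rewrite ler_wpM2l//; lra.
have h3 : expR r * (axis_norm x + 2) <= expR e * (axis_norm x + 2).
  by rewrite ler_wpM2r ?ler_expR//; lra.
by move: h3; rewrite -{1}cosh_add_sinh; lra.
Qed.

(** This pairing is the exponential of a Busemann function at the endpoint [y + w]. It cannot
    vanish, since its product with the pairing at [y - w] is at least 1. *)
Lemma busemann_gt0 x : on_hyperboloid x -> 0 < - lform x (y + w).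
Proof.
move=> xH; have /hyperboloidP[xx _] := xH.
have h : lform x (y - w) * lform x (y + w) >= 1.
  by have := axis_form_ge0 x; rewrite axis_formE xx; lra.
have le0 : lform x (y + w) <= 0.
  have /hyperboloidP[_ x0] := xH; have /andP[yw1 _] := unit_tangent_time yw.
  have yy' := yy; have ww' := ww; have wy' := wy0; have yw' := yw0.
  by apply: causal_le0; rewrite ?mxE ?lformL; lra.
rewrite oppr_gt0 lt_neqAle le0 andbT; apply/eqP => e0.
by move: h; rewrite e0 mulr0; lra.
Qed.

(** Busemann functions are 1-Lipschitz: the pairing of the null vectors [x - u] and [y + w] has a
    sign, which bounds the derivative along the geodesic. *)
Lemma busemann_near e x x' : 0 <= e -> on_hyperboloid x ->
  on_hyperboloid x' -> - lform x x' <= cosh e ->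
  - lform x' (y + w) <= expR e * - lform x (y + w).
Proof.
move=> e0 xH xH' xx'; have b0 := ltW (busemann_gt0 x xH).
have [xe|xne] := eqVneq (lform x x') (-1).
  rewrite -(hyperboloid_lform_eq _ _ xH xH' xe).
  have E1 : 1 <= expR e by rewrite -expR0 ler_expR.
  by have := ler_wpM2r b0 E1; lra.
have [r [u [r0 xu re ->]]] := hyperboloid_geodesic _ _ xH xH' xne.
have r_le_e : r <= e.
  rewrite leNgt; apply/negP => er; have := ltr_cosh _ _ e0 er; lra.
have := unit_tangent_lform_le0 _ _ _ _ (unit_tangentN _ _ xu) yw.
rewrite !lformDl lformNl !lformZl => h.
have : sinh r * - lform u (y + w) <= sinh r * - lform x (y + w).
  by apply: ler_wpM2l; [exact/ltW/sinh_gt0|lra].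
have : expR r * - lform x (y + w) <= expR e * - lform x (y + w).
  by rewrite ler_wpM2r ?ler_expR//; lra.
by rewrite -{1}cosh_add_sinh; lra.
Qed.

End AxisDistance.

(** * Numerical estimates and fellow-travelling with an axis *)

Section FellowTravel.
Context {R : realType}.

Lemma expRN_small (e : R) : 0 < e -> exists2 c : R, 0 < c & expR (- c) <= e.
Proof.
move=> e0; have ei : 0 < e^-1 by rewrite invr_gt0.
exists e^-1 => //; rewrite expRN -[leRHS]invrK lef_pV2 ?posrE ?expR_gt0//.
by have := expR_ge1Dx e^-1; lra.
Qed.

(* The two ends of a segment whose translate by [s] stays close to it can only be
   at bounded distance from the axis: [al] and [be] are the contributions of
   its two endpoints at infinity. *)
Lemma ends_near_axis (al be i j th E N0 Ns Nl Nsl : R) :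
  0 <= al -> 0 <= be -> 0 <= i <= th -> 0 <= j <= th -> 1 <= E ->
  6 * (E * th) <= 1 ->
  al <= Nsl + i * j * be -> Nl <= al * i + be * j -> Nsl <= E * (Nl + 2) ->
  be <= N0 + i * j * al -> Ns <= al * j + be * i -> N0 <= E * (Ns + 2) ->
  al + be <= 8 * E.
Proof.
move=> al0 be0 /andP[i0 ith] /andP[j0 jth] E1 Eth h1 h2 h3 h4 h5 h6.
have th0 : 0 <= th by lra.
have thE : th <= E * th by rewrite ler_peMl.
have ij : i * j <= E * th.
  have : i * j <= th * 1 by apply: ler_pM; lra.
  by lra.
have E0 : 0 <= E by lra.
have k (a c : R) : 0 <= a -> 0 <= c <= th -> E * (a * c) <= E * th * a.
  move=> a0 /andP[c0 cth]; rewrite -mulrA ler_wpM2l// mulrC.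
  by rewrite ler_wpM2r.
have k1 : E * (Nl + 2) <= E * (al * i + be * j + 2) by rewrite ler_wpM2l//; lra.
have k2 : E * (Ns + 2) <= E * (al * j + be * i + 2) by rewrite ler_wpM2l//; lra.
(* The two chains of inequalities add up to [al + be <= 3 * (E * th) * (al + be) + 4 * E], and
   [6 * (E * th) <= 1] absorbs half of the left side. *)
have := k al i al0; have := k be j be0; have := k al j al0; have := k be i be0.
rewrite i0 ith j0 jth => /(_ isT) a1 /(_ isT) a2 /(_ isT) a3 /(_ isT) a4.
have b1 := ler_wpM2r al0 ij; have b2 := ler_wpM2r be0 ij.
have c1 := ler_wpM2r al0 Eth; have c2 := ler_wpM2r be0 Eth.
lra.
Qed.

(* In the application [Y] is close to 4 and [Z] to 0 when the geodesic and the axis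
   point in the same direction, and conversely when they are opposite. *)
Lemma same_direction (al be i j th E K P Q Y Z : R) :
  0 <= al -> 0 <= be -> 0 <= i <= th -> 0 <= j <= th -> 1 <= E -> E <= K ->
  8 <= K -> al + be <= K -> 64 * (K ^+ 6 * th) <= 1 ->
  P = 4 * (i * j * al) ^+ 2 -> Q = 4 * be ^+ 2 -> 0 <= Y -> 0 <= Z ->
  Y * Z = P * Q -> `|Y + Z - 4| <= 8 * (i * j * al * be) ->
  Z <= E ^+ 2 * (P + Y + i ^+ 2 * (Z + Q)) ->
  1 <= Y /\ Y <= 4 + 2 * (th * K ^+ 2).
Proof.
move=> al0 be0 /andP[i0 ith] /andP[j0 jth] E1 EK K8 aK Kth PE QE Y0 Z0 YZ.
move=> /ler_normlP[h1 h2] h3.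
have th0 : 0 <= th by lra.
have K0 : 0 <= K by lra.
have K1 : 1 <= K by lra.
have Kn m n : (m <= n)%N -> K ^+ m * th <= K ^+ n * th.
  by move=> mn; rewrite ler_wpM2r// ler_weXn2l.
have th1 : th <= 1.
  have := Kn 0%N 6%N isT; rewrite expr0; lra.
have ab : al * be <= K ^+ 2 / 4.
  have := sqr_ge0 (al - be); have : (al + be) ^+ 2 <= K ^+ 2.
    by rewrite ler_sqr ?nnegrE//; lra.
  by lra.
have ab0 : 0 <= al * be by exact: mulr_ge0.
have al2 : al ^+ 2 <= K ^+ 2 by rewrite ler_sqr ?nnegrE//; lra.
have be2 : be ^+ 2 <= K ^+ 2 by rewrite ler_sqr ?nnegrE//; lra.
have ij0 : 0 <= i * j by exact: mulr_ge0.
have ijth : i * j <= th.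
  have : i * j <= th * 1 by apply: ler_pM; lra.
  by lra.
have ij2 : (i * j) ^+ 2 <= th.
  have : i * j * (i * j) <= th * 1 by apply: ler_pM; lra.
  by lra.
have i2 : i ^+ 2 <= th.
  have : i * i <= th * 1 by apply: ler_pM; lra.
  by rewrite expr2; lra.
have om : i * j * al * be <= th * (K ^+ 2 / 4).
  by rewrite -mulrA; apply: ler_pM.
have Y4 : Y <= 4 + 2 * (th * K ^+ 2) by lra.
(* If [Y < 1], then [Z >= 2] because [Y + Z] is close to 4, and [Y] is small because [Y * Z = P * Q]
   is. The last hypothesis then bounds [Z] by a small constant plus a small multiple of [Z], a
   contradiction. *)
split => //; rewrite leNgt; apply/negP => Y1.
have P1 : P <= 4 * (K ^+ 2 * th).
  rewrite PE exprMn.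
  have : (i * j) ^+ 2 * al ^+ 2 <= th * K ^+ 2 by apply: ler_pM; rewrite ?sqr_ge0.
  by lra.
have Q1 : Q <= 4 * K ^+ 2 by lra.
have Q0 : 0 <= Q by rewrite QE mulr_ge0// sqr_ge0.
have P0 : 0 <= P by rewrite PE mulr_ge0// sqr_ge0.
have iQ : i ^+ 2 * Q <= th * (4 * K ^+ 2).
  by apply: ler_pM; rewrite ?sqr_ge0.
have k2 := Kn 2%N 6%N isT; have k4 := Kn 4%N 6%N isT.
have Z2 : 2 <= Z by lra.
have PQ : Y * Z <= K ^+ 4 * th.
  rewrite YZ PE QE.
  have : (i * j) ^+ 2 * (al * be) ^+ 2 <= th * (K ^+ 2 / 4) ^+ 2.
    by apply: ler_pM; rewrite ?sqr_ge0// ler_sqr ?nnegrE//; lra.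
  have -> : (i * j) ^+ 2 * (al * be) ^+ 2 =
    4 * (i * j * al) ^+ 2 * (4 * be ^+ 2) / 16 by field.
  have -> : th * (K ^+ 2 / 4) ^+ 2 = K ^+ 4 * th / 16 by field.
  by lra.
have Yth : Y <= K ^+ 4 * th.
  have : Y * 1 <= Y * Z by rewrite ler_wpM2l//; lra.
  by lra.
have E2 : E ^+ 2 <= K ^+ 2 by rewrite ler_sqr ?nnegrE//; lra.
have iZ : i ^+ 2 * Z <= th * Z by rewrite ler_wpM2r.
have a0 : 0 <= P + Y + i ^+ 2 * (Z + Q).
  by rewrite !addr_ge0// mulr_ge0 ?sqr_ge0 ?addr_ge0.
have h4 : Z <= K ^+ 2 * (4 * (K ^+ 2 * th) + K ^+ 4 * th + (th * Z + th * (4 * K ^+ 2))).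
  apply: (le_trans h3); apply: ler_pM; rewrite ?sqr_ge0//.
  by lra.
have k24 : K ^+ 2 * (K ^+ 2 * th) = K ^+ 4 * th by ring.
have k46 : K ^+ 2 * (K ^+ 4 * th) = K ^+ 6 * th by ring.
have k2Z : K ^+ 2 * th * Z <= K ^+ 6 * th * Z by rewrite ler_wpM2r.
have k6Z : 64 * (K ^+ 6 * th) * Z <= 1 * Z by rewrite ler_wpM2r.
lra.
Qed.

(* Here [T] stands for [expR t], [S] for the square root of [Y], and [A + B + 2 S]
   is four times [cosh] of a distance. *)
Lemma cosh_dist_le (al be i j th K kap ze P Q Y S A B T T' : R) :
  0 <= al -> 0 <= be -> 0 <= i <= th -> 0 <= j <= th -> al + be <= K ->
  th <= 1 -> 0 <= ze <= 1 -> 4 * (ze * K ^+ 2) <= kap ->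
  2 * (th * K ^+ 2) <= kap ->
  P = 4 * (i * j * al) ^+ 2 -> Q = 4 * be ^+ 2 ->
  1 <= Y -> Y <= 4 + 8 * (i * j * al * be) -> 0 <= S -> S ^+ 2 = Y ->
  0 <= A -> 0 <= B -> A * S = T ^+ 2 * P -> B * S = T' ^+ 2 * Q ->
  0 <= T -> 0 <= T' -> T' <= ze -> T * (i * j) <= ze ->
  (A + B + 2 * S) / 4 <= 1 + kap.
Proof.
move=> al0 be0 /andP[i0 ith] /andP[j0 jth] aK th1 /andP[ze0 ze1] zeK thK PE QE.
move=> Y1 Y4 S0 SY A0 B0 AE BE T0 T'0 Tze' Tze.
have S1 : 1 <= S.
  rewrite leNgt; apply/negP => S1.
  by have : S * S <= S * 1 by [rewrite ler_wpM2l//; lra]; rewrite -expr2; lra.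
have AS : A <= A * S by rewrite ler_peMr.
have BS : B <= B * S by rewrite ler_peMr.
have th0 : 0 <= th by lra.
have K0 : 0 <= K by lra.
have ij0 : 0 <= i * j by exact: mulr_ge0.
have ijth : i * j <= th.
  have : i * j <= th * 1 by apply: ler_pM; lra.
  by lra.
have ab : al * be <= K ^+ 2 / 4.
  have := sqr_ge0 (al - be); have : (al + be) ^+ 2 <= K ^+ 2.
    by rewrite ler_sqr ?nnegrE//; lra.
  by lra.
have ab0 : 0 <= al * be by exact: mulr_ge0.
have om : i * j * al * be <= th * (K ^+ 2 / 4).
  by rewrite -mulrA; apply: ler_pM.
have al2 : al ^+ 2 <= K ^+ 2 by rewrite ler_sqr ?nnegrE//; lra.
have be2 : be ^+ 2 <= K ^+ 2 by rewrite ler_sqr ?nnegrE//; lra.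
have zz : ze ^+ 2 <= ze by rewrite expr2 ler_piMr.
(* [A] and [B] are the contributions of the two ends of the segment, small because the time is far
   from both. *)
have A1 : A <= 4 * (ze * K ^+ 2).
  have -> : 4 * (ze * K ^+ 2) = ze * (4 * K ^+ 2) by ring.
  apply: (le_trans AS); rewrite AE PE.
  have -> : T ^+ 2 * (4 * (i * j * al) ^+ 2) =
    (T * (i * j)) ^+ 2 * (4 * al ^+ 2) by ring.
  have tt : (T * (i * j)) ^+ 2 <= ze.
    by apply: le_trans zz; rewrite ler_sqr ?nnegrE ?mulr_ge0.
  by apply: ler_pM; rewrite ?mulr_ge0 ?sqr_ge0//; lra.
have B1 : B <= 4 * (ze * K ^+ 2).
  have -> : 4 * (ze * K ^+ 2) = ze * (4 * K ^+ 2) by ring.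
  apply: (le_trans BS); rewrite BE QE.
  have tt : T' ^+ 2 <= ze.
    by apply: le_trans zz; rewrite ler_sqr ?nnegrE.
  by apply: ler_pM; rewrite ?mulr_ge0 ?sqr_ge0//; lra.
(* The square of the right side exceeds [4 + 8 * (i * j * al * be)], hence [Y]. *)
have S2 : S <= 2 + 2 * (i * j * al * be).
  have o0 : 0 <= i * j * al * be by rewrite -mulrA mulr_ge0.
  rewrite -ler_sqr ?nnegrE//; last by lra.
  by have := sqr_ge0 (i * j * al * be); lra.
lra.
Qed.

(** The geodesic is a combination of the null vectors [x + u] and [x - u], so everything reduces to
    their pairings with the endpoints [y + w] and [y - w] of the axis, to which the three preceding
    estimates apply. *)
Lemma fellow_travel (e0 : R) : 0 < e0 ->
  exists c0 T0 : R, [/\ 0 < c0, 0 < T0 &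
  forall (d : nat) (x u y w : 'rV[R]_d.+1) (g : 'M[R]_d.+1) (tau s l : R),
    unit_tangent x u -> unit_tangent y w -> hyp_isometry g ->
    0 <= tau -> y *m g = cosh tau *: y + sinh tau *: w ->
    w *m g = sinh tau *: y + cosh tau *: w ->
    T0 <= s -> T0 <= l ->
    - lform (x *m g) (cosh s *: x + sinh s *: u) <= cosh e0 ->
    - lform ((cosh l *: x + sinh l *: u) *m g)
        (cosh (s + l) *: x + sinh (s + l) *: u) <= cosh e0 ->
    tau <= s + e0 /\
    exists r, forall t, c0 <= t <= s + l - c0 ->
      - lform (cosh t *: x + sinh t *: u)
         (cosh (t + r) *: y + sinh (t + r) *: w) <= cosh (e0 / 2)].
Proof.
move=> e0_gt0; set E := expR e0; set K := 8 * E.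
have E1 : 1 <= E by rewrite -expR0 ler_expR ltW.
have K8 : 8 <= K by rewrite /K; lra.
set kap := cosh (e0 / 2) - 1.
have kap0 : 0 < kap.
  have e2 : 0 < e0 / 2 by rewrite divr_gt0.
  by have := ltr_cosh _ _ (lexx 0) e2; rewrite cosh0 /kap; lra.
have K20 : 0 < K ^+ 2 by rewrite exprn_gt0//; lra.
have K60 : 0 < K ^+ 6 by rewrite exprn_gt0//; lra.
(* [ze] will bound [expR (- c0)] and [th] will bound [expR (- T0)]; the minima collect the smallness
   conditions of the three estimates. *)
pose ze := Num.min 1 (kap / (4 * K ^+ 2)).
have ze0 : 0 < ze by rewrite lt_min ltr01 divr_gt0// mulr_gt0.
have ze1 : ze <= 1 by rewrite ge_min lexx.
have zeK : 4 * (ze * K ^+ 2) <= kap.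
  have : ze <= kap / (4 * K ^+ 2) by rewrite ge_min lexx orbT.
  by rewrite ler_pdivlMr ?mulr_gt0//; lra.
pose th := Num.min (64 * K ^+ 6)^-1 (kap / (2 * K ^+ 2)).
have th0 : 0 < th by rewrite lt_min invr_gt0 mulr_gt0//= divr_gt0// mulr_gt0.
have thK : 2 * (th * K ^+ 2) <= kap.
  have : th <= kap / (2 * K ^+ 2) by rewrite ge_min lexx orbT.
  by rewrite ler_pdivlMr ?mulr_gt0//; lra.
have Kth : 64 * (K ^+ 6 * th) <= 1.
  have : th <= (64 * K ^+ 6)^-1 by rewrite ge_min lexx.
  by rewrite -[X in _ <= X]div1r ler_pdivlMr ?mulr_gt0//; lra.
have Eth : 6 * (E * th) <= 1.
  have : 1 * (K * th) <= K ^+ 5 * (K * th).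
    apply: ler_wpM2r; first by rewrite mulr_ge0//; lra.
    by apply: exprn_ege1; lra.
  by rewrite {1}/K; lra.
have th1 : th <= 1.
  by have : 1 * th <= E * th by [rewrite ler_wpM2r//; lra]; lra.
have [c0 c00 c0ze] := expRN_small _ ze0.
have [T0 T00 T0th] := expRN_small _ th0.
exists c0, T0; split=> // d x u y w g tau s l xu yw gI tau0 yg wg Ts Tl hs hl.
have gform : forall z z', lform (z *m g) (z' *m g) = lform z z' by case: gI.
have gH : forall z, on_hyperboloid z -> on_hyperboloid (z *m g) by case: gI.
have yNw := unit_tangentN _ _ yw; have xNu := unit_tangentN _ _ xu.
pose G t := cosh t *: x + sinh t *: u.
have GE t : G t = (expR t / 2) *: (x + u) + (expR (- t) / 2) *: (x - u).
  by apply/rowP => k; rewrite !mxE /cosh /sinh; lra.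
have GH t : on_hyperboloid (G t).
  by have /unit_tangentP[] := unit_tangent_flow t xu.
have G0 : G 0 = x by rewrite /G cosh0 sinh0 scale1r scale0r addr0.
(* Exponentials of the Busemann functions at the repelling and attracting endpoints of [g]; [g]
   multiplies them by [expR tau] and [expR (- tau)], which makes the axis seminorm invariant. *)
pose a z := - lform z (y - w); pose b z := - lform z (y + w).
have [xx xu0 uu] : [/\ lform x x = -1, lform x u = 0 & lform u u = 1].
  by have /unit_tangentP[/hyperboloidP[]] := xu.
have xH : on_hyperboloid x by have /unit_tangentP[] := xu.
have ag z : a (z *m g) = expR tau * a z.
  have : (y - w) *m g = expR (- tau) *: (y - w).
    rewrite mulmxBl yg wg -cosh_sub_sinh; apply/rowP => k; rewrite !mxE; ring.
  move=> h; have := gform z (y - w); rewrite h lformZr /a => <-.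
  by rewrite mulrN mulrA expR_mulN mul1r.
have bg z : b (z *m g) = expR (- tau) * b z.
  have : (y + w) *m g = expR tau *: (y + w).
    rewrite mulmxDl yg wg -cosh_add_sinh; apply/rowP => k; rewrite !mxE; ring.
  move=> h; have := gform z (y + w); rewrite h lformZr /b => <-.
  by rewrite mulrN mulrA (mulrC (expR (- _))) expR_mulN mul1r.
have Ng z : axis_norm y w (z *m g) = axis_norm y w z.
  congr Num.sqrt; rewrite !axis_formE gform.
  have := expR_mulN tau; have := ag z; have := bg z; rewrite /a /b.
  move=> hb ha h; congr (_ + _).
  have -> : lform (z *m g) (y - w) = expR tau * lform z (y - w) by lra.
  have -> : lform (z *m g) (y + w) = expR (- tau) * lform z (y + w) by lra.
  by rewrite mulrACA h mul1r.
have e0_ge0 := ltW e0_gt0.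
have ap z : on_hyperboloid z -> 0 < a z by exact: busemann_gt0.
have bp z : on_hyperboloid z -> 0 < b z by exact: busemann_gt0.
have a1 : expR tau * a x <= E * a (G s).
  rewrite -ag; apply: busemann_near => //.
  - exact/gH/xH.
  - by rewrite lformC.
have b1 : b (G s) <= E * b x.
  apply: (@le_trans _ _ (E * b (x *m g))).
    by apply: busemann_near => //; exact/gH/xH.
  rewrite bg ler_wpM2l ?expR_ge0// -[leRHS]mul1r ler_wpM2r//.
    exact/ltW/bp/xH.
  by rewrite -expR0 ler_expR; lra.
have a2 : a (G s) <= expR s * a x.
  apply: busemann_near => //; first lra.
  by rewrite /G !lformL xx xu0; lra.
(* Moving [x] by [g] multiplies [a] by [expR tau], whereas flowing for time [s] and then moving by
   [e0] multiplies it by at most [expR (s + e0)]. *)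
have tau_le : tau <= s + e0.
  have : expR tau * a x <= E * expR s * a x.
    by rewrite -mulrA; apply: (le_trans a1); rewrite ler_wpM2l ?expR_ge0.
  by rewrite ler_pM2r ?ap ?xH// -expRD ler_expR addrC.
split=> //.
have a12 : a x <= E * a (G s).
  apply: le_trans a1; rewrite -[leLHS]mul1r ler_wpM2r//.
    exact/ltW/ap/xH.
  by rewrite -expR0 ler_expR.
have [i0 ith] : 0 < expR (- s) /\ expR (- s) <= th.
  by split; [exact: expR_gt0|rewrite (le_trans _ T0th)// ler_expR lerN2].
have [j0 jth] : 0 < expR (- l) /\ expR (- l) <= th.
  by split; [exact: expR_gt0|rewrite (le_trans _ T0th)// ler_expR lerN2].
have sij : expR (- (s + l)) = expR (- s) * expR (- l) by rewrite opprD expRD.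
have si1 := expR_mulN s; have lj1 := expR_mulN l.
set i := expR (- s) in i0 ith sij si1 *; set j := expR (- l) in j0 jth sij lj1 *.
pose N := axis_norm y w; pose np := N (x + u); pose nm := N (x - u).
have np0 : 0 <= np by exact: axis_norm_ge0.
have nm0 : 0 <= nm by exact: axis_norm_ge0.
have eh t : 0 <= expR t / 2 by rewrite divr_ge0 ?expR_ge0.
have Nle t : N (G t) <= expR t / 2 * np + expR (- t) / 2 * nm.
  rewrite GE; apply: (le_trans (axis_norm_lin _ _ yw _ _ _ _)).
  by rewrite !ger0_norm.
have Ngp t : expR t / 2 * np <= N (G t) + expR (- t) / 2 * nm.
  rewrite -[X in X * np]ger0_norm// -axis_normZ.
  have -> : (expR t / 2) *: (x + u) = 1 *: G t + (- (expR (- t) / 2)) *: (x - u).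
    by rewrite GE; apply/rowP => k; rewrite !mxE; ring.
  apply: (le_trans (axis_norm_lin _ _ yw _ _ _ _)).
  by rewrite normr1 normrN !ger0_norm// mul1r.
have Ngm t : expR (- t) / 2 * nm <= N (G t) + expR t / 2 * np.
  rewrite -[X in X * nm]ger0_norm// -axis_normZ.
  have -> : (expR (- t) / 2) *: (x - u) = 1 *: G t + (- (expR t / 2)) *: (x + u).
    by rewrite GE; apply/rowP => k; rewrite !mxE; ring.
  apply: (le_trans (axis_norm_lin _ _ yw _ _ _ _)).
  by rewrite normr1 normrN !ger0_norm// mul1r.
(* [al] is the seminorm of the [x + u] term at the final time [s + l], and [be] that of the [x - u]
   term at time 0. *)
pose al := expR s * expR l / 2 * np; pose be := nm / 2.
have al0 : 0 <= al by rewrite mulr_ge0// -expRD.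
have be0 : 0 <= be by rewrite divr_ge0.
have ali : i * j * al = np / 2.
  rewrite /al; have -> : i * j * (expR s * expR l / 2 * np) =
    (expR s * i) * (expR l * j) * np / 2 by field.
  by rewrite si1 lj1 !mul1r.
have alK : al + be <= K.
  have I : 0 <= i <= th by rewrite ltW.
  have J : 0 <= j <= th by rewrite ltW.
  apply: (ends_near_axis al be i j th E (N x) (N (G s)) (N (G l))
    (N (G (s + l)))) => //.
  - by have := Ngp (s + l); rewrite sij expRD /al /be; lra.
  - have := Nle l; rewrite -/j /al /be.
    have -> : expR s * expR l / 2 * np * i = (expR s * i) * expR l / 2 * np by ring.
    by rewrite si1; lra.
  - by rewrite /N -(Ng (G l)); apply: axis_norm_near => //; exact/gH.
  - by have := Ngm 0; rewrite oppr0 expR0 G0 ali /be; lra.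
  - have := Nle s; rewrite -/i /al /be.
    have -> : expR s * expR l / 2 * np * j = (expR l * j) * expR s / 2 * np by ring.
    by rewrite lj1; lra.
  - rewrite /N -(Ng x); apply: axis_norm_near => //; first exact/gH/xH.
    by rewrite lformC.
(* Pairings of the endpoints of the geodesic with those of the axis. When the directions agree, [p']
   and [q] are the small ones and [p * q'] is close to 4. *)
pose p := a (x + u); pose q := a (x - u).
pose p' := b (x + u); pose q' := b (x - u).
have p0 : 0 <= p by rewrite oppr_ge0; exact: unit_tangent_lform_le0.
have q0 : 0 <= q by rewrite oppr_ge0; exact: unit_tangent_lform_le0.
have p'0 : 0 <= p' by rewrite oppr_ge0; exact: unit_tangent_lform_le0.
have q'0 : 0 <= q' by rewrite oppr_ge0; exact: unit_tangent_lform_le0.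
have ux0 : lform u x = 0 by rewrite lformC.
have PE : p * p' = np ^+ 2.
  rewrite /np sqr_axis_norm// axis_formE /p /p' /a /b.
  by rewrite [lform (x + u) (x + u)]lformDl !lformDr xx xu0 ux0 uu; ring.
have QE : q * q' = nm ^+ 2.
  rewrite /nm sqr_axis_norm// axis_formE /q /q' /a /b.
  rewrite [lform (x - u) (x - u)]lformDl !lformDr !lformNl !lformNr.
  by rewrite xx xu0 ux0 uu; ring.
have YZ : `|p * q' + p' * q - 4| <= 2 * (np * nm).
  have := axis_form_CS y w yw (x + u) (x - u).
  have -> : axis_form y w (x + u) (x - u) = (p * q' + p' * q - 4) / 2.
    by rewrite /axis_form /p /q /p' /q' /a /b !lformL xx xu0 ux0 uu; field.
  rewrite -[axis_norm y w (x + u)]/np -[axis_norm y w (x - u)]/nm.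
  by rewrite normrM [ `|2^-1|]ger0_norm//; clear; lra.
have aE t : a (G t) = expR t / 2 * p + expR (- t) / 2 * q.
  by rewrite /a GE lformDl !lformZl /p /q /a; ring.
have bE t : b (G t) = expR t / 2 * p' + expR (- t) / 2 * q'.
  by rewrite /b GE lformDl !lformZl /p' /q' /b; ring.
have ax : a x = (p + q) / 2 by rewrite -G0 aE oppr0 expR0; field.
have bx : b x = (p' + q') / 2 by rewrite -G0 bE oppr0 expR0; field.
(* Multiplying [a x <= E * a (G s)] by [b (G s) <= E * b x] expresses that the geodesic does not run
   backwards along the axis; the factor [i] removes the growth in [s]. *)
have dir : p' * q <= E ^+ 2 * (p * p' + p * q' + i ^+ 2 * (p' * q + q * q')).
  have ia : i * a (G s) = (p + i ^+ 2 * q) / 2.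
    rewrite aE -/i.
    have -> : i * (expR s / 2 * p + i / 2 * q) =
      (expR s * i) * p / 2 + i ^+ 2 * q / 2 by field.
    by rewrite si1; field.
  have ib : i * b (G s) = (p' + i ^+ 2 * q') / 2.
    rewrite bE -/i.
    have -> : i * (expR s / 2 * p' + i / 2 * q') =
      (expR s * i) * p' / 2 + i ^+ 2 * q' / 2 by field.
    by rewrite si1; field.
  have : a x * (i * b (G s)) <= E * (i * a (G s)) * (E * b x).
    have -> : a x * (i * b (G s)) = i * (a x * b (G s)) by ring.
    have -> : E * (i * a (G s)) * (E * b x) = i * (E * a (G s) * (E * b x)) by ring.
    apply: ler_wpM2l; first exact: ltW.
    by apply: ler_pM => //; apply: ltW; [exact: ap|exact: bp].
  rewrite ia ib ax bx.
  have := mulr_ge0 p0 p'0.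
  have := mulr_ge0 (sqr_ge0 i) (mulr_ge0 p0 q'0).
  have := mulr_ge0 (sqr_ge0 i) (mulr_ge0 q0 q'0).
  clear; lra.
have I : 0 <= i <= th by rewrite ltW.
have J : 0 <= j <= th by rewrite ltW.
have PE' : p * p' = 4 * (i * j * al) ^+ 2 by rewrite ali PE; field.
have QE' : q * q' = 4 * be ^+ 2 by rewrite /be QE; field.
have be2 : i * j * al * be = np * nm / 4 by rewrite ali /be; field.
have [Y1 _] : 1 <= p * q' /\ p * q' <= 4 + 2 * (th * K ^+ 2).
  apply: (same_direction al be i j th E K (p * p') (q * q') _ (p' * q)) => //.
  - by rewrite /K; clear -E1; lra.
  - exact: mulr_ge0.
  - exact: mulr_ge0.
  - by ring.
  - by rewrite be2 (le_trans YZ)//; clear; lra.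
have Y4 : p * q' <= 4 + 8 * (i * j * al * be).
  have /ler_normlP[_] := YZ; have := mulr_ge0 p'0 q0.
  by rewrite be2; clear; lra.
have pq'0 : 0 < p * q' by exact: lt_le_trans Y1.
have q'1 : 0 < q'.
  by rewrite lt_neqAle q'0 andbT; apply: contraTneq pq'0 => <-; rewrite mulr0 ltxx.
have p1 : 0 < p.
  by rewrite lt_neqAle p0 andbT; apply: contraTneq pq'0 => <-; rewrite mul0r ltxx.
(* This shift balances the mixed terms: [expR r * q'] and [expR (- r) * p] have the common value
   [S], with [S ^+ 2 = p * q']. *)
exists (ln (p / q') / 2) => t /andP[tc tsl].
set r := ln _ / 2; have rr := expR_mulN r.
have rho2 : expR r ^+ 2 = p / q'.
  by rewrite -expRM_natl /r mulrCA mulfV// mulr1 lnK// posrE divr_gt0.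
pose S := expR r * q'.
have S0 : 0 <= S by rewrite mulr_ge0 ?expR_ge0.
have pS : p = expR r * S.
  by rewrite /S mulrA -expr2 rho2 mulfVK// gt_eqF.
have Sp : expR (- r) * p = S.
  by rewrite [in LHS]pS mulrA (mulrC (expR (- r))) rr mul1r.
have S2 : S ^+ 2 = p * q'.
  by rewrite /S exprMn rho2 expr2 mulrA mulfVK// gt_eqF.
have tt := expR_mulN t.
have -> : - lform (cosh t *: x + sinh t *: u)
   (cosh (t + r) *: y + sinh (t + r) *: w) =
   (expR t ^+ 2 * expR r * p' + expR (- t) ^+ 2 * expR (- r) * q + 2 * S) / 4.
  have -> : cosh (t + r) *: y + sinh (t + r) *: w =
    (expR t * expR r / 2) *: (y + w) + (expR (- t) * expR (- r) / 2) *: (y - w).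
    apply/rowP => k; rewrite !mxE /cosh /sinh opprD !expRD; clear; lra.
  have -> : - lform (G t) ((expR t * expR r / 2) *: (y + w) +
      (expR (- t) * expR (- r) / 2) *: (y - w)) =
    expR t * expR r / 2 * b (G t) + expR (- t) * expR (- r) / 2 * a (G t).
    by rewrite lformDr !lformZr /a /b; ring.
  rewrite aE bE.
  have -> : expR t * expR r / 2 * (expR t / 2 * p' + expR (- t) / 2 * q') +
     expR (- t) * expR (- r) / 2 * (expR t / 2 * p + expR (- t) / 2 * q) =
   (expR t ^+ 2 * expR r * p' + expR (- t) ^+ 2 * expR (- r) * q +
    (expR t * expR (- t)) * (expR r * q' + expR (- r) * p)) / 4 by field.
  by rewrite tt Sp -/S mul1r -mulr2n mulr_natl.
have -> : cosh (e0 / 2) = 1 + kap by rewrite /kap addrC subrK.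
apply: (cosh_dist_le al be i j th K kap ze (p * p') (q * q') (p * q') S _ _
  (expR t) (expR (- t))) => //.
- by rewrite ltW.
- by rewrite !mulr_ge0// ?sqr_ge0 ?expR_ge0.
- by rewrite !mulr_ge0// ?sqr_ge0 ?expR_ge0.
- rewrite -Sp; have -> : expR t ^+ 2 * expR r * p' * (expR (- r) * p) =
    expR t ^+ 2 * (expR r * expR (- r)) * (p * p') by ring.
  by rewrite rr mulr1.
- rewrite /S; have -> : expR (- t) ^+ 2 * expR (- r) * q * (expR r * q') =
    expR (- t) ^+ 2 * (expR r * expR (- r)) * (q * q') by ring.
  by rewrite rr mulr1.
- by apply: le_trans c0ze; rewrite ler_expR lerN2.
- rewrite -sij -expRD; apply: le_trans c0ze; rewrite ler_expR.
  by move: tsl; clear; lra.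
Qed.
End FellowTravel.

(** * The quotient metric *)

Section HypDist.
Context {R : realType} {d : nat}.
Implicit Types x y z : hyp R d.

Lemma hyp_lform_ge1 x y : 1 <= - lform x y.
Proof. by have := hyperboloid_lform _ _ (hypP x) (hypP y); lra. Qed.

Lemma hyp_dist_ge0 x y : 0 <= hyp_dist x y.
Proof. exact/arcosh_ge0/hyp_lform_ge1. Qed.

Lemma cosh_hyp_dist x y : cosh (hyp_dist x y) = - lform x y.
Proof. exact/cosh_arcosh/hyp_lform_ge1. Qed.

Lemma hyp_distC x y : hyp_dist x y = hyp_dist y x.
Proof. by rewrite /hyp_dist lformC. Qed.

Lemma hyp_dist_le x y r : 0 <= r ->
  (hyp_dist x y <= r) = (- lform x y <= cosh r).
Proof.
move=> r0; rewrite -cosh_hyp_dist; apply/idP/idP => [|h].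
  exact/ler_cosh/hyp_dist_ge0.
by rewrite leNgt; apply/negP => /(ltr_cosh _ _ r0); rewrite ltNge h.
Qed.

Lemma hyp_distE x y r : 0 <= r -> - lform x y = cosh r -> hyp_dist x y = r.
Proof.
move=> r0 h; apply/eqP; rewrite eq_le hyp_dist_le// h lexx/= leNgt.
by apply/negP => /(ltr_cosh _ _ (hyp_dist_ge0 x y)); rewrite cosh_hyp_dist h ltxx.
Qed.

Lemma hyp_dist_triangle y x z : hyp_dist x z <= hyp_dist x y + hyp_dist y z.
Proof.
rewrite hyp_dist_le ?addr_ge0 ?hyp_dist_ge0//.
apply: (lform_triangle x y z); rewrite ?hyp_dist_ge0 ?cosh_hyp_dist//; exact: hypP.
Qed.

Lemma hyp_footE (p : unithyp R d) : hyp_foot p = p.1 :> 'rV_d.+1.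
Proof. by case: p. Qed.

Lemma hyp_flow0 (p : unithyp R d) : hyp_flow 0 p = p.
Proof.
apply: val_inj; case: p => -[x u] xu /=.
by rewrite cosh0 sinh0 !scale1r !scale0r addr0 add0r.
Qed.

Lemma hyp_flowD s t (p : unithyp R d) :
  hyp_flow s (hyp_flow t p) = hyp_flow (t + s) p.
Proof.
apply: val_inj; case: p => -[x u] xu /=; rewrite coshD sinhD.
by congr pair; apply/rowP => k; rewrite !mxE; ring.
Qed.

Lemma lform_hyp_flow (p : unithyp R d) s t :
  - lform (hyp_flow s p).1 (hyp_flow t p).1 = cosh (t - s).
Proof.
case: p => -[x u] /= xu; have /unit_tangentP[/hyperboloidP[xx _] xu0 uu] := xu.
rewrite !lformL xx xu0 (lformC u) xu0 uu coshD coshN sinhN; ring.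
Qed.

Lemma hyp_dist_flow (p : unithyp R d) s t : s <= t ->
  hyp_dist (hyp_foot (hyp_flow s p)) (hyp_foot (hyp_flow t p)) = t - s.
Proof.
by move=> st; apply: hyp_distE; rewrite ?subr_ge0// !hyp_footE lform_hyp_flow.
Qed.

Lemma hyp_geodesic_to x y : 0 < hyp_dist x y -> exists p : unithyp R d,
  hyp_foot p = x /\ hyp_foot (hyp_flow (hyp_dist x y) p) = y.
Proof.
move=> xy; have ne : lform x y != -1.
  apply/eqP => e; move: xy; rewrite ltNge hyp_dist_le// e opprK cosh0 lexx//.
have [r [u [r0 xu rE yE]]] := hyperboloid_geodesic _ _ (hypP x) (hypP y) ne.
rewrite (hyp_distE _ _ _ (ltW r0) rE).
exists (UnitHyp (unithyp_val := (hyp_val x, u)) xu).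
by split; apply: val_inj => /=; [|exact/esym].
Qed.

End HypDist.

(** * The lattice action, lifts and the quotient metric *)

Section Isometry.
Context {R : realType} {d : nat} (G : isom_group R d).
Local Open Scope quotient_scope.
Local Notation M := (qman G).
Local Notation SM := (unitM G).

Lemma isom_lform g x y : isom_set G g -> lform (x *m g) (y *m g) = lform x y.
Proof. by move=> /isom_group_sub[]. Qed.

Lemma isom_hyperboloid g x : isom_set G g -> on_hyperboloid x ->
  on_hyperboloid (x *m g).
Proof. by move=> /isom_group_sub[] _ _; apply. Qed.

Lemma isom_unit_tangent g x u : isom_set G g -> unit_tangent x u ->
  unit_tangent (x *m g) (u *m g).
Proof.
move=> Gg /unit_tangentP[xH xu uu]; apply/unit_tangentP.
by rewrite !isom_lform//; split=> //; exact: isom_hyperboloid.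
Qed.

Definition hyp_act g (Gg : isom_set G g) (x : hyp R d) : hyp R d :=
  Hyp (isom_hyperboloid g x Gg (hypP x)).

Definition unithyp_act g (Gg : isom_set G g) (p : unithyp R d) : unithyp R d :=
  UnitHyp (unithyp_val := (p.1 *m g, p.2 *m g))
    (isom_unit_tangent g _ _ Gg (unithypP p)).

Lemma qmanP (x y : hyp R d) :
  \pi_M x = \pi_M y <-> exists g (Gg : isom_set G g), y = hyp_act g Gg x.
Proof.
split=> [/(@eqmodP _ (hyp_rel_equiv G))/asboolP[g Gg yE]|[g [Gg ->]]].
  by exists g, Gg; exact: val_inj.
by apply/(@eqmodP _ (hyp_rel_equiv G))/asboolP; exists g.
Qed.

Lemma unitMP (p q : unithyp R d) :
  \pi_SM p = \pi_SM q <-> exists g (Gg : isom_set G g), q = unithyp_act g Gg p.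
Proof.
split=> [/(@eqmodP _ (unithyp_rel_equiv G))/asboolP[g Gg [q1 q2]]|[g [Gg ->]]].
  exists g, Gg; apply: val_inj => /=; case: q q1 q2 => -[q1 q2] /= _.
  by move=> -> ->.
by apply/(@eqmodP _ (unithyp_rel_equiv G))/asboolP; exists g.
Qed.

Lemma hyp_dist_act g (Gg : isom_set G g) x y :
  hyp_dist (hyp_act g Gg x) (hyp_act g Gg y) = hyp_dist x y.
Proof. by rewrite /hyp_dist isom_lform. Qed.

Lemma pi_act g (Gg : isom_set G g) x : \pi_M (hyp_act g Gg x) = \pi_M x.
Proof. by apply/esym/qmanP; exists g, Gg. Qed.

Lemma distM_has_inf (p q : M) :
  has_inf [set r | exists x y : hyp R d,
        [/\ \pi_M x = p, \pi_M y = q & r = hyp_dist x y]].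
Proof.
split; last by exists 0 => _ [x [y [_ _ ->]]]; exact: hyp_dist_ge0.
exists (hyp_dist (repr p) (repr q)), (repr p), (repr q); split=> //; exact: reprK.
Qed.

Lemma distM_ge0 p q : 0 <= distM (G := G) p q.
Proof.
apply: lb_le_inf; first by case: (distM_has_inf p q).
by move=> _ [x [y [_ _ ->]]]; exact: hyp_dist_ge0.
Qed.

Lemma distM_le (x y : hyp R d) : distM (\pi_M x) (\pi_M y) <= hyp_dist x y.
Proof.
apply: ge_inf; first by case: (distM_has_inf (\pi_M x) (\pi_M y)).
by exists x, y.
Qed.

(** The lattice acts by isometries, so in the infimum over pairs of lifts one lift can be kept
    fixed. *)
Lemma distM_lt (x y : hyp R d) r : distM (\pi_M x) (\pi_M y) < r ->
  exists g (Gg : isom_set G g), hyp_dist (hyp_act g Gg x) y < r.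
Proof.
move=> /(inf_lt (proj1 (distM_has_inf _ _)))[_ [x' [y' [xx' yy' ->]]]].
have /qmanP[g [Gg ->]] := esym yy'; have /qmanP[h [Gh ->]] := esym xx'.
have Gghi := isom_groupM Gh (isom_groupV Gg).
exists _, Gghi; rewrite -(hyp_dist_act g Gg).
have -> // : hyp_act g Gg (hyp_act _ Gghi x) = hyp_act h Gh x.
apply: val_inj => /=; rewrite -!mulmxA; congr (_ *m _).
by rewrite mulVmx ?mulmx1//; exact: (isom_group_unit Gg).
Qed.

Lemma distMC p q : distM (G := G) p q = distM q p.
Proof.
by congr inf; apply/seteqP; split=> _ [x [y [hx hy ->]]]; exists y, x;
  split=> //; exact: hyp_distC.
Qed.

Lemma distM_triangle q p r : distM (G := G) p r <= distM p q + distM q r.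
Proof.
apply/ler_addgt0Pr => e e0; have e2 : 0 < e / 2 by exact: divr_gt0.
have [g [Gg h1]] := distM_lt (repr p) (repr q) (distM p q + e / 2)
  ltac:(by rewrite !reprK ltrDl).
have [h [Gh h2]] := distM_lt (repr r) (repr q) (distM q r + e / 2)
  ltac:(by rewrite !reprK distMC ltrDl).
have := distM_le (hyp_act g Gg (repr p)) (hyp_act h Gh (repr r)).
rewrite !pi_act !reprK => /le_trans; apply.
apply: (le_trans (hyp_dist_triangle (repr q) _ _)).
by rewrite (hyp_distC (repr q)); lra.
Qed.

Lemma geod_pi p t : geod (\pi_SM p) t = \pi_M (hyp_foot (hyp_flow t p)).
Proof. by rewrite /geod flow_pi foot_pi. Qed.

Lemma unitM_pi (v : SM) : exists p, v = \pi_SM p.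
Proof. by exists (repr v); rewrite reprK. Qed.

Lemma flowD s t (v : SM) : flow s (flow t v) = flow (t + s) v.
Proof. by have [p ->] := unitM_pi v; rewrite !flow_pi hyp_flowD. Qed.

Lemma geod_flow s t (v : SM) : geod (flow s v) t = geod v (s + t).
Proof. by rewrite /geod flowD. Qed.

Lemma distM_geod (v : SM) s t : s <= t -> distM (geod v s) (geod v t) <= t - s.
Proof.
move=> st; have [p ->] := unitM_pi v; rewrite !geod_pi; apply: (le_trans (distM_le _ _)).
by rewrite hyp_dist_flow.
Qed.

Lemma dist_upto_has_sup l (v w : SM) : 0 <= l ->
  has_sup [set distM (geod v t) (geod w t) | t in `[0, l]].
Proof.
move=> l0; split.
  by exists (distM (geod v 0) (geod w 0)), 0; rewrite //= in_itv/= lexx l0.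
exists (l + (distM (geod v 0) (geod w 0) + l)) => _ [t + <-].
rewrite /= in_itv/= => /andP[t0 tl].
apply: (le_trans (distM_triangle (geod v 0) _ _)).
have := distM_triangle (geod w 0) (geod v 0) (geod w t).
have := distM_geod v _ _ t0; have := distM_geod w _ _ t0.
rewrite (distMC (geod v t)); lra.
Qed.

Lemma distM_le_dist_upto l (v w : SM) t : 0 <= t <= l ->
  distM (geod v t) (geod w t) <= dist_upto l v w.
Proof.
move=> /andP[t0 tl]; apply: sup_upper_bound.
  by apply: dist_upto_has_sup; exact: le_trans tl.
by exists t; rewrite //= in_itv/= t0.
Qed.

Lemma dist_upto_le l (v w : SM) r : 0 <= l ->
  (forall t, 0 <= t <= l -> distM (geod v t) (geod w t) <= r) ->
  dist_upto l v w <= r.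
Proof.
move=> l0 h; apply: ge_sup; first by case: (dist_upto_has_sup l v w l0).
by move=> _ [t + <-]; rewrite /= in_itv/=; exact: h.
Qed.

Lemma exp_injective_lt r r' p : r <= r' -> exp_injective (G := G) p r' ->
  exp_injective p r.
Proof.
move=> rr' h u u' s s' hu hu' /andP[s0 sr] /andP[s'0 s'r]; apply: h => //.
  by rewrite s0 (lt_le_trans sr).
by rewrite s'0 (lt_le_trans s'r).
Qed.

Lemma inj_radius_exp_injective r p : (r%:E < inj_radius G)%E ->
  exp_injective (G := G) p r.
Proof.
move=> /lt_le_trans h; have /h : (inj_radius G <= inj_radius_at p)%E.
  by apply: ereal_inf_lbound; exists p.
move=> /ereal_sup_gt[_ [r' [_ r'inj] <-]]; rewrite lte_fin => /ltW rr'.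
exact: exp_injective_lt r'inj.
Qed.

(** On a shorter closed geodesic the times 0 and [cg_len a] would have the same image inside a ball
    on which the exponential map is injective. *)
Lemma closed_geodesic_length_ge r (a : closed_geodesic G) :
  (forall p, exp_injective (G := G) p r) -> r <= cg_len a.
Proof.
move=> inj; rewrite leNgt; apply/negP => ar.
have a0 := cg_len_gt0 a; have r0 := lt_trans a0 ar.
have f0 : flow 0 (cg_dir a) = cg_dir a.
  by have [p ->] := unitM_pi (cg_dir a); rewrite flow_pi hyp_flow0.
have [] := inj (foot (cg_dir a)) (cg_dir a) (cg_dir a) (cg_len a) 0 erefl erefl.
- by rewrite ltW.
- by rewrite lexx.
- by rewrite /geod cg_closed f0.
by move=> e; rewrite e ltxx in a0.
Qed.

End Isometry.

(** * Existence of axes *)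

Lemma injective_finite_set (T : choiceType) (F : finType) (A : set T) (x0 : T)
    (f : T -> F) : {in A &, injective f} -> finite_set A.
Proof.
(* [A] lies in the image of a choice of preimages; [x0] is the default value off the range of
   [f]. *)
move=> finj; apply: (@sub_finite_set _ _
  ((fun t => xget x0 [set a | A a /\ f a = t]) @` [set: F])).
  move=> a Aa; exists (f a) => //.
  have := xgetPex x0 (ex_intro (fun b => A b /\ f b = f a) a (conj Aa erefl)).
  by case=> Ab fb; apply: finj; rewrite ?inE.
exact/finite_image/finite_finset.
Qed.

Lemma finite_set_min (T : choiceType) (R : realDomainType) (A : set T)
    (f : T -> R) : finite_set A -> A !=set0 ->
  exists2 a, A a & forall b, A b -> f a <= f b.
Proof.
move=> /finite_seqP[s ->] [a0 /= a0s]; elim: s a0 a0s => // a s IH a0 _.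
case: s IH => [_|b s IH]; first by exists a; rewrite /= ?mem_head// => b;
  rewrite inE => /eqP ->.
have [c cs cmin] := IH b (mem_head _ _).
have [ac|ca] := leP (f a) (f c).
  exists a => [|e]; first exact: mem_head.
  by rewrite /= inE => /predU1P[->//|/cmin]; exact: le_trans.
exists c => [|e]; first by rewrite /= inE cs orbT.
by rewrite /= inE => /predU1P[->|/cmin//]; exact: ltW.
Qed.

Section BasePoint.
Context {R : realType} {d : nat}.

Lemma base_subproof : on_hyperboloid (delta_mx 0 0 : 'rV[R]_d.+1).
Proof.
apply/hyperboloidP; rewrite lformE !mxE /sform big1 => [|i _].
  rewrite !eqxx /= mulr1 sub0r; split=> //; exact: ltr01.
by rewrite !mxE /= mul0r.
Qed.

(** The apex of the hyperboloid. Pairing with it reads off the time coordinate, so the entry [g 0 0]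
    is [cosh] of the displacement of [base] under [g]. *)
Definition base : hyp R d := Hyp base_subproof.

Lemma lform_base (x : 'rV[R]_d.+1) : lform base x = - x 0 0.
Proof.
rewrite lformE /sform big1 => [|i _]; last by rewrite !mxE /= mul0r.
by rewrite !mxE !eqxx mul1r sub0r.
Qed.

Lemma lform_base_mul (g : 'M[R]_d.+1) : - lform base (base *m g) = g 0 0.
Proof. by rewrite lform_base opprK -rowE mxE. Qed.

End BasePoint.

Section LformContinuous.
Context {R : realType} {d : nat}.

Lemma lform_continuous {T : topologicalType} (f g : T -> 'rV[R]_d.+1) :
  (forall k, continuous (fun t => f t 0 k)) ->
  (forall k, continuous (fun t => g t 0 k)) ->
  continuous (fun t => lform (f t) (g t)).
Proof.
move=> cf cg; rewrite /lform.
have cfg k l : continuous (fun t => f t 0 k * g t 0 l : R^o).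
  by move=> t; apply: cvgM; [exact: cf|exact: cg].
move=> t; apply: (@cvgD _ R^o); first by apply: (@cvgN _ R^o); exact: cfg.
apply: (@continuous_big R^o); first exact: add_continuous.
by move=> i _; exact: cfg.
Qed.

Lemma mulmx_coord_continuous {T : topologicalType} (f : T -> 'rV[R]_d.+1)
    (g : 'M[R]_d.+1) k :
  (forall l, continuous (fun t => f t 0 l)) ->
  continuous (fun t => (f t *m g) 0 k).
Proof.
move=> cf; rewrite (_ : (fun t => _) = fun t => \sum_l f t 0 l * g l k); last first.
  by apply/funext => t; rewrite mxE.
apply: (@continuous_big R^o); first exact: add_continuous.
by move=> l _ t; apply: cvgM; [exact: cf|exact: cvg_cst].
Qed.

Lemma hyperboloid_entry_le (y : 'rV[R]_d.+1) k :
  on_hyperboloid y -> `|y 0 k| <= y 0 0.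
Proof.
move=> /hyperboloidP[]; rewrite lformE => yy y0.
case: (unliftP ord0 k) => [i ->|->]; last by rewrite gtr0_norm.
rewrite -ler_sqr ?nnegrE//; last exact: ltW.
rewrite real_normK ?num_real//; have := sqr_coord_le_sform y i.
by lra.
Qed.

Lemma hyperboloid_time_ge1 (y : 'rV[R]_d.+1) : on_hyperboloid y -> 1 <= y 0 0.
Proof.
move=> yH; have := hyperboloid_lform _ _ base_subproof yH.
by rewrite (lform_base y); lra.
Qed.

Lemma hyperboloid_compact (C : R) :
  compact [set y : 'rV[R]_d.+1 | on_hyperboloid y /\ y 0 0 <= C].
Proof.
have box : compact [set v : 'rV[R]_d.+1 | forall i, v ord0 i \in `[- C, C]].
  apply: (@rV_compact _ _ (fun=> `[- C, C]%classic)) => _.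
  exact: segment_compact.
apply: subclosed_compact box _; last first.
  move=> y [yH yC] i; rewrite in_itv /= -ler_norml.
  by apply: le_trans yC; exact: hyperboloid_entry_le.
have cy k : continuous (fun y : 'rV[R]_d.+1 => y 0 k) by exact: coord_continuous.
(* Positivity of the time coordinate is not a closed condition; on the hyperboloid it amounts to
   being at least 1. *)
rewrite (_ : mkset _ = (fun y => lform y y) @^-1` [set z | z = -1] `&`
  ((fun y => y 0 0) @^-1` [set z | 1 <= z] `&` (fun y => y 0 0) @^-1` [set z | z <= C])).
  apply: closedI; [|apply: closedI].
  - by apply: preimage_closed; [move=> y _; exact: lform_continuous|exact: closed_eq].
  - by apply: preimage_closed; [move=> y _; exact: cy|exact: closed_ge].
  - by apply: preimage_closed; [move=> y _; exact: cy|exact: closed_le].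
apply/seteqP; split=> y /=.
  move=> [yH yC]; have /hyperboloidP[yy _] := yH.
  by split=> //; split=> //; exact: hyperboloid_time_ge1.
by move=> [yy [y1 yC]]; split=> //; apply/hyperboloidP; split=> //; lra.
Qed.

End LformContinuous.

(** * Discreteness, cocompactness and minimal displacement *)

Section Discrete.
Context {R : realType} {d : nat} (G : isom_group R d).
Hypothesis G_lattice : cocompact_lattice G.
Local Open Scope quotient_scope.
Local Notation M := (qman G).

Lemma discrete_at1 : exists2 e : R, 0 < e & forall g, isom_set G g ->
  (forall i j, `|g i j - (1 : 'M[R]_d.+1) i j| < e) -> g = 1.
Proof.
have [_ [V V1 VG]] : isolated G 1 by rewrite (proj1 G_lattice); exact: isom_group1.
have /nbhs_ballP[e /= e0 eV] := V1.
exists e => // g Gg ge; have : (V `&` G) g.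
  split=> //; apply: eV; split=> // i j.
  by rewrite /ball /= distrC.
by rewrite VG.
Qed.

(** Row 0 of [g] is a point of the hyperboloid and every other row is a unit tangent vector
    there. *)
Lemma isom_entry_le g i j : isom_set G g -> `|g i j| <= 1 + g 0 0.
Proof.
move=> Gg; have row_eq k : row k g = delta_mx 0 k *m g by rewrite rowE.
have g00 : (row 0 g) 0 0 = g 0 0 by rewrite mxE.
have g0H : on_hyperboloid (row 0 g).
  by rewrite row_eq; apply: (isom_hyperboloid G) => //; exact: base_subproof.
have /hyperboloidP[g0g0 g0p] := g0H; rewrite g00 in g0p.
case: (unliftP ord0 i) => [i' ->|->]; last first.
  by have := hyperboloid_entry_le (row 0 g) j g0H; rewrite !mxE; lra.
have ut : unit_tangent (row 0 g) (row (lift ord0 i') g).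
  rewrite !row_eq; apply: (isom_unit_tangent G) => //; apply/unit_tangentP.
  split; first exact: base_subproof.
    by rewrite (lform_base (delta_mx 0 _)) mxE /= oppr0.
  rewrite lformE /sform (bigD1 i')//= big1 => [|k ki].
    by rewrite !mxE /= !eqxx /= mulr1 mul0r subr0 addr0.
  by rewrite !mxE /= (inj_eq lift_inj) (negbTE ki) mul0r.
have := unit_tangent_time ut; rewrite !mxE => /andP[gi1 gi2].
case: (unliftP ord0 j) => [j' ->|->]; last by rewrite ler_norml; lra.
have := sqr_coord_le_sform (row (lift ord0 i') g) j'.
have /unit_tangentP[_ _] := ut; rewrite lformE !mxE => h h'.
have g2 : g (lift ord0 i') 0 * g (lift ord0 i') 0 <= g 0 0 ^+ 2.
  rewrite -expr2 -[X in X <= _]real_normK ?num_real// ler_sqr ?nnegrE//; last by lra.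
  by rewrite ler_norml gi1.
have : g (lift ord0 i') (lift ord0 j') ^+ 2 <= (1 + g 0 0) ^+ 2 by lra.
by rewrite -[X in X <= _]real_normK ?num_real// ler_sqr ?nnegrE//; lra.
Qed.

Lemma isom_inv00 g : isom_set G g -> g^-1 0 0 = g 0 0.
Proof.
move=> Gg; rewrite -!lform_base_mul -(isom_lform G g) // -mulmxA.
by rewrite mulVmx ?mulmx1 1?lformC//; exact: (isom_group_unit Gg).
Qed.

(** Pigeonhole: the entries are bounded, and two elements whose entries fall into the same small
    cells have a quotient close to 1, hence equal to 1 by discreteness. *)
Lemma finite_isom (C : R) : finite_set [set g | isom_set G g /\ g 0 0 <= C].
Proof.
have [e e0 eG] := discrete_at1.
have [C0|C0] := ltP C 0.
  rewrite (_ : mkset _ = set0); first exact: finite_set0.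
  apply/seteqP; split=> // g [Gg gC]; have := isom_entry_le g 0 0 Gg.
  have := isom_hyperboloid G _ _ Gg (hypP (base : hyp R d)).
  by move=> /hyperboloidP[_]; rewrite -rowE mxE; lra.
pose B := 1 + C; have B0 : 0 < B by rewrite /B; lra.
(* An entry of [g^-1 *m h - 1] is a sum of [d.+1] products, each at most [B * de] in absolute value;
   the total is [e / 2]. *)
pose de := e / (2 * (d.+1%:R * B)).
have dB0 : 0 < 2 * (d.+1%:R * B) by rewrite !mulr_gt0.
have de0 : 0 < de by rewrite divr_gt0.
pose N := Num.truncn (2 * B / de).
pose f (g : 'M[R]_d.+1) : {ffun 'I_d.+1 * 'I_d.+1 -> 'I_N.+1} :=
  [ffun ij => inord (Num.truncn ((g ij.1 ij.2 + B) / de))].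
apply: (@injective_finite_set _ _ _ 1 f) => g h.
rewrite !inE => -[Gg gC] [Gh hC] /ffunP fgh.
have close i j : `|h i j - g i j| < de.
  have bnd k : isom_set G k -> k 0 0 <= C -> 0 <= (k i j + B) / de /\
      (Num.truncn ((k i j + B) / de) < N.+1)%N.
    move=> Gk kC; have := isom_entry_le k i j Gk.
    rewrite ler_norml => /andP[k1 k2]; split.
      by apply: divr_ge0; [rewrite /B; lra|exact: ltW].
    rewrite ltnS; apply: le_truncn; rewrite ler_pM2r ?invr_gt0//.
    by rewrite /B; lra.
  have [g0 gN] := bnd g Gg gC; have [h0 hN] := bnd h Gh hC.
  have := congr1 val (fgh (i, j)); rewrite !ffunE /= !inordK// => E.
  have := truncn_itv g0; have := truncn_itv h0; rewrite E.
  rewrite !ler_pdivlMr// !ltr_pdivrMr// -[_.+1%:R]natr1 => /andP[h1 h2] /andP[g1 g2].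
  by rewrite ltr_norml; apply/andP; split; lra.
have Gg' := isom_groupV Gg.
suff e1 : g^-1 *m h = 1.
  by rewrite -[RHS]mul1mx -(mulmxV (isom_group_unit Gg)) -mulmxA e1 mulmx1.
apply: eG => [|i j]; first exact: isom_groupM.
have -> : (1 : 'M[R]_d.+1) = g^-1 *m g.
  by rewrite mulVmx//; exact: (isom_group_unit Gg).
rewrite !mxE -sumrB (le_lt_trans (ler_norm_sum _ _ _))//.
apply: (@le_lt_trans _ _ (\sum_(k < d.+1) B * de)).
  apply: ler_sum => k _; rewrite -mulrBr normrM.
  apply: ler_pM => //; last exact/ltW.
  by rewrite (le_trans (isom_entry_le _ i k Gg'))// isom_inv00// /B; lra.
rewrite sumr_const card_ord -mulr_natl /de.
rewrite (_ : _ * _ = e / 2); first by lra.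
by field; rewrite ?gt_eqF.
Qed.

(** The classes with a representative of time coordinate below a given bound form an open set; these
    sets exhaust the compact quotient. *)
Lemma cocompact_bound : exists C : R, forall x : hyp R d,
  exists2 g, isom_set G g & (x *m g) 0 0 <= C.
Proof.
have cont (g : 'M[R]_d.+1) : continuous (fun x : hyp R d => ((x : 'rV[R]_d.+1) *m g) 0 0).
  apply: mulmx_coord_continuous => l x.
  apply: (@continuous_comp _ _ _ (@hyp_val R d) (fun y => y 0 l)).
    exact: initial_continuous.
  exact: coord_continuous.
have := proj2 G_lattice; rewrite compact_near_coveringP => cov.
pose P (k : nat) (p : M) := exists2 x : hyp R d, \pi_M x = p & x 0 0 < k%:R.
have : \forall k \near \oo, [set: M] `<=` P k.
  apply: cov => p _.
  pose r := repr p 0 0 + 1.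
  pose U := [set q : M | exists2 x : hyp R d, \pi_M x = q & x 0 0 < r].
  (* Openness in the quotient topology: the preimage of [U] is a union, over the lattice, of open
     sets. *)
  have oU : open U.
    rewrite /open /= /quotient_open.
    rewrite (_ : _ @^-1` _ = \bigcup_(g in G)
      ((fun x : hyp R d => ((x : 'rV[R]_d.+1) *m g) 0 0) @^-1` [set y | y < r])).
      apply: bigcup_open => g _; apply: open_comp; last exact: open_lt.
      by move=> x _; exact: cont.
    apply/seteqP; split=> x /=.
      move=> [y /esym/qmanP[g [Gg ->]] yr]; exists g => //.
    move=> [g Gg xr]; exists (hyp_act G g Gg x) => //; exact: pi_act.
  exists (U, [set k : nat | r <= k%:R]) => /=.
    split; first by apply: open_nbhs_nbhs; split=> //; exists (repr p); 
      rewrite ?reprK// /r ltrDl.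
    exists (Num.truncn r).+1 => // k /=; rewrite -(ler_nat R).
    by apply: le_trans; rewrite ltW// truncnS_gt.
  by move=> [q k] /= [[x xq xr] rk]; exists x => //; exact: lt_le_trans rk.
move=> [k _ /(_ k (leqnn k)) kP]; exists k%:R => x.
have [y /esym/qmanP[g [Gg yE]] yk] := kP (\pi_M x) I.
by exists g => //; move: yk; rewrite yE /=; exact: ltW.
Qed.

(** The displacement of [g] at [y] equals that of [k^-1 * g * k] at [y *m k], and [k] can bring [y]
    into a compact set. Only finitely many conjugates displace a point of it at most as much as [g]
    displaces [base], so the minimum is taken over these conjugates and the compact set. *)
Lemma min_displacement g : isom_set G g -> exists2 x : 'rV[R]_d.+1,
  on_hyperboloid x & forall y, on_hyperboloid y ->
    lform y (y *m g) <= lform x (x *m g).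
Proof.
move=> Gg; have [C CG] := cocompact_bound.
pose K := [set y : 'rV[R]_d.+1 | on_hyperboloid y /\ y 0 0 <= C].
pose f (h : 'M[R]_d.+1) (y : 'rV[R]_d.+1) := - lform y (y *m h).
have [k0 Gk0 Kk0] := CG base.
have K0 : K !=set0.
  by exists (base *m k0); split=> //; apply: (isom_hyperboloid G) => //; exact: hypP.
have C1 : 1 <= C.
  by case: K0 => y [/hyperboloid_time_ge1]; exact: le_trans.
have minK h : exists2 y, K y & forall y', K y' -> f h y <= f h y'.
  have [|c cK cmax] := @compact_EVT_max _ R
    (fun y => lform y (y *m h)) K K0 (hyperboloid_compact C).
    have c : continuous (fun y : 'rV[R]_d.+1 => lform y (y *m h)).
      apply: lform_continuous => k; first exact: coord_continuous.
      by apply: mulmx_coord_continuous => l; exact: coord_continuous.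
    exact: continuous_subspaceT.
  exists c => [|y' /mem_set Ky']; first exact/set_mem.
  by rewrite lerN2; exact: cmax.
have /choice[m mP] : forall h, exists y, K y /\ forall y', K y' -> f h y <= f h y'.
  by move=> h; have [y ? ?] := minK h; exists y.
pose b := hyp_act G g Gg base.
(* Bounds the displacement of [base] by such a conjugate, passing through a point [z] of the compact
   set and its image. *)
pose D := arcosh C + hyp_dist base b + arcosh C.
pose S := [set h | exists2 k, isom_set G k & h = k^-1 * g * k] `&`
  [set h | isom_set G h /\ h 0 0 <= cosh D].
have conj k y : isom_set G k -> f (k^-1 * g * k) (y *m k) = f g y.
  move=> Gk; rewrite /f -!mulmxA.
  have -> : k *m (k^-1 * g * k) = g *m k.
    by rewrite !mulmxA mulmxV ?mul1mx//; exact: (isom_group_unit Gk).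
  by rewrite [y *m (g *m k)]mulmxA (isom_lform G).
have inS k (y : hyp R d) : isom_set G k -> (y *m k) 0 0 <= C ->
    f g y <= f g base -> S (k^-1 * g * k).
  move=> Gk yC fy.
  have Gh : isom_set G (k^-1 * g * k).
    by apply: isom_groupM => //; apply: isom_groupM => //; exact: isom_groupV.
  split; first by exists k.
  split=> //; pose z := hyp_act G k Gk y.
  pose h := k^-1 * g * k; pose zh := hyp_act G h Gh z.
  have baseh : h 0 0 = cosh (hyp_dist base (hyp_act G h Gh base)).
    by rewrite cosh_hyp_dist lform_base_mul.
  rewrite -/h baseh; apply: ler_cosh; first exact: hyp_dist_ge0.
  have bz : hyp_dist base z <= arcosh C.
    rewrite hyp_dist_le ?arcosh_ge0// cosh_arcosh// lform_base opprK.
    exact: yC.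
  have zzh : hyp_dist z zh <= hyp_dist base b.
    rewrite hyp_dist_le ?hyp_dist_ge0// cosh_hyp_dist.
    have := conj _ y Gk; rewrite /f /= => ->.
    exact: fy.
  have := hyp_dist_triangle z base (hyp_act G h Gh base).
  have := hyp_dist_triangle zh z (hyp_act G h Gh base).
  by rewrite hyp_dist_act (hyp_distC z base) /D; lra.
have S0 : S !=set0 by exists (k0^-1 * g * k0); exact: (inS _ base).
have Sfin : finite_set S.
  by apply: sub_finite_set (finite_isom (cosh D)) => h [].
have [h [[k Gk hE] _] hmin] := finite_set_min _ _ _ (fun h => f h (m h)) Sfin S0.
have Gk' := isom_groupV Gk; have [[mH mC] _] := mP h.
have fgh : f g (m h *m k^-1) = f h (m h).
  rewrite -(conj k)// -hE -mulmxA mulVmx ?mulmx1//.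
  exact: (isom_group_unit Gk).
exists (m h *m k^-1); first exact: (isom_hyperboloid G).
(* Points displaced more than [base] are handled by the comparison with [base]. *)
suff le y : on_hyperboloid y -> f g y <= f g base -> f g (m h *m k^-1) <= f g y.
  move=> y yH; rewrite -lerN2 -/(f g y) -/(f g _).
  have [fy|fy] := leP (f g y) (f g base); first exact: le.
  by apply: le_trans (ltW fy); apply: le => //; exact: base_subproof.
move=> yH fy; have [k' Gk'' yC] := CG (Hyp yH).
rewrite fgh -(conj k')//; apply: (@le_trans _ _ (f (k'^-1 * g * k') (m (k'^-1 * g * k')))).
  by apply: hmin; exact: (inS _ (Hyp yH)).
have [_] := mP (k'^-1 * g * k'); apply; split=> //.
exact: (isom_hyperboloid G).
Qed.

End Discrete.

(** * The axis through a point of minimal displacement *)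

Section Axis.
Context {R : realType} {d : nat}.
Implicit Types (x y : 'rV[R]_d.+1) (g : 'M[R]_d.+1).

(* At a point of minimal displacement the midpoint of [x] and [x g] cannot be
   displaced less, which forces [x], [x g] and [x g^2] to lie on one geodesic. *)
Lemma axis_of_min_displacement g x : hyp_isometry g -> on_hyperboloid x ->
  lform x (x *m g) != -1 ->
  (forall y, on_hyperboloid y -> lform y (y *m g) <= lform x (x *m g)) ->
  exists w tau, [/\ 0 < tau, unit_tangent x w,
    x *m g = cosh tau *: x + sinh tau *: w &
    w *m g = sinh tau *: x + cosh tau *: w].
Proof.
move=> [_ gform gH] xH ne gmin.
have xgH := gH _ xH; have xggH := gH _ xgH.
have [tau [w [tau0 xw fE xgE]]] := hyperboloid_geodesic _ _ xH xgH ne.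
exists w, tau; split=> //.
have /hyperboloidP[xx x0] := xH; have /hyperboloidP[xgxg xg0] := xgH.
have s0 := sinh_gt0 _ tau0; have cs := cosh2_sinh2 tau.
have c1 : 1 < cosh tau by have := ltr_cosh _ _ (lexx 0) tau0; rewrite cosh0.
set f := cosh tau in fE cs c1 *; set xg := x *m g in xgE fE gmin xgxg xg0 xgH xggH *.
have xxg : lform x xg = - f by lra.
have xgxgg : lform xg (xg *m g) = - f by rewrite gform.
have xggxgg : lform (xg *m g) (xg *m g) = -1 by rewrite gform.
(* The right side is [cosh] of the distance from [x] to its second image, the left side is
   [cosh (2 * tau)]. The factor [c] normalises the midpoint [c *: (x + xg)]. *)
have f2 : 2 * f ^+ 2 - 1 <= - lform x (xg *m g).
  have [c c0 c2] : exists2 c : R, 0 < c & c ^+ 2 * (2 + 2 * f) = 1.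
    exists (Num.sqrt (2 + 2 * f))^-1; first by rewrite invr_gt0 sqrtr_gt0; lra.
    by rewrite exprVn sqr_sqrtr ?mulVf ?gt_eqF//; lra.
  have mH : on_hyperboloid (c *: (x + xg)).
    apply/hyperboloidP; rewrite !lformL xx xgxg (lformC xg x) xxg.
    split; first by lra.
    have -> (a b : 'rV[R]_d.+1) : (c *: (a + b)) 0 0 = c * (a 0 0 + b 0 0).
      by rewrite !mxE.
    by rewrite mulr_gt0// addr_gt0.
  have := gmin _ mH.
  rewrite -scalemxAl mulmxDl !lformL -/xg xxg xgxg xgxgg => h.
  have h2 : 0 <= 2 + 2 * f by lra.
  have : c ^+ 2 * (2 + 2 * f) * (- (2 * f) - 1 + lform x (xg *m g)) <=
    (2 + 2 * f) * - f.
    by apply: le_trans (ler_wpM2l h2 h); rewrite le_eqVlt; apply/orP; left;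
      apply/eqP; ring.
  by rewrite c2; lra.
(* This vector is orthogonal to [xg], and [f2] makes its square nonpositive, so it vanishes. *)
have z0 : (1 *: x + 1 *: (xg *m g)) + (- (2 * f)) *: xg = 0.
  apply: (spacelike_eq0 xg _ xgH).
    by rewrite !lformL (lformC xg x) xxg xgxgg xgxg; ring.
  rewrite !lformL (lformC xg x) (lformC (xg *m g) x) (lformC (xg *m g) xg).
  rewrite xx xxg xgxgg xgxg xggxgg.
  by lra.
have {z0} xggE : xg *m g = (2 * f) *: xg - x.
  apply/eqP; rewrite -subr_eq0 opprB -z0; apply/eqP/rowP => k; rewrite !mxE.
  ring.
have : sinh tau *: (w *m g) = sinh tau *: (sinh tau *: x + f *: w).
  have -> : sinh tau *: (w *m g) = xg *m g - f *: xg.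
    by rewrite {1}xgE mulmxDl -!scalemxAl addrAC subrr add0r.
  rewrite xggE xgE; apply/rowP => k; rewrite !mxE.
  have : (f ^+ 2 - sinh tau ^+ 2) * x 0 k = x 0 k by rewrite cs mul1r.
  by rewrite -/f; lra.
by move=> /(scalerI (lt0r_neq0 s0)).
Qed.

End Axis.

(** * Aperiodic and bounded rays *)

Lemma phi_invP (R : realType) (e0 : R) (phi : R -> R) (a : R) :
  increasing_invertible e0 phi -> e0 < a ->
  1 < phi_inv phi a /\ phi (phi_inv phi a) = a.
Proof.
move=> [bij _] e0a; have aI : `]e0, +oo[%classic a by rewrite /= in_itv/= e0a.
split.
  have [h _ _] := bijpinv_bij (fun=> 0) bij.
  by have := h a aI; rewrite /= in_itv/= andbT.
have [_ _ h] := bij; apply: (surjpK (fun=> 0) h).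
exact/mem_set.
Qed.

Section ClosedManifold.
Context {R : realType} {d : nat} (G : isom_group R d) (e0 : R).
Hypothesis e0_gt0 : 0 < e0.
Hypothesis inj : forall p, exp_injective (G := G) p (2 * e0).
Local Open Scope quotient_scope.
Local Notation M := (qman G).
Local Notation SM := (unitM G).

Lemma aperiodic_bounded (o : M) (v : SM) (phi : R -> R) :
  foot v = o -> increasing_invertible e0 phi ->
  aperiodic `]1, +oo[%classic phi e0 0 v -> bounded_all e0 o phi v.
Proof.
move=> vo phiI ap a _; split=> // t0 t00; have a0 := cg_len_gt0 a.
have a2 := closed_geodesic_length_ge G _ a inj.
have e0a : e0 < cg_len a by lra.
have [i1 phii] := phi_invP _ _ _ _ phiI e0a.
rewrite /penetration; case: ifP => _; first by rewrite lee_fin; lra.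
apply: ge_ereal_sup => _ [L [L0 [t /andP[t_ge0 ta] h]] <-].
rewrite lee_fin leNgt; apply/negP => Llt.
set b := phi_inv phi (cg_len a) in i1 phii Llt.
have bL : b < L - cg_len a by lra.
(* Aperiodicity with shift [cg_len a]: both points are [e0 / 2]-close to the same point of the
   closed geodesic. The length lies in the domain of [phi] because it exceeds [b > 1]. *)
have pL : phi (L - cg_len a) <= cg_len a.
  apply: (ap t0 _ (L - cg_len a)) => //; [lra|by rewrite /= in_itv/= andbT; lra|].
  apply: dist_upto_le => [|r /andP[r0 rl]]; first by lra.
  rewrite !geod_flow.
  apply: (le_trans (distM_triangle G (geod (cg_dir a) (t + r)) _ _)).
  have h1 : distM (geod v (t0 + r)) (geod (cg_dir a) (t + r)) <= e0 / 2.
    have rL : 0 <= r <= L by lra.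
    by have := distM_le_dist_upto G L (flow t0 v) (flow t (cg_dir a)) r rL;
      rewrite !geod_flow; lra.
  have h2 : distM (geod (cg_dir a) (t + r)) (geod v (t0 + cg_len a + r)) <= e0 / 2.
    have rL : 0 <= r + cg_len a <= L by lra.
    have := distM_le_dist_upto G L (flow t0 v) (flow t (cg_dir a)) _ rL.
    rewrite !geod_flow distMC.
    have -> : t0 + cg_len a + r = t0 + (r + cg_len a) by ring.
    have -> : t + (r + cg_len a) = cg_len a + (t + r) by ring.
    by rewrite -(geod_flow _ (cg_len a)) cg_closed; lra.
  by lra.
have : phi b < phi (L - cg_len a).
  by apply: (proj2 phiI) => //; rewrite in_itv/= andbT; lra.
by rewrite phii; lra.
Qed.

(** Some lift [h x] comes within [e0 + de] of [y]. Both lifts of the same point lie in the ball of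
    radius [2 * e0] about [y], where the exponential map is injective, so their distances to [y]
    agree. *)
Lemma nearby_lift_dist g (Gg : isom_set G g) (x y : hyp R d) :
  distM (\pi_M x) (\pi_M y) <= e0 -> hyp_dist (hyp_act G g Gg x) y < 2 * e0 ->
  hyp_dist (hyp_act G g Gg x) y <= e0.
Proof.
move=> xy gxy; have e0p := e0_gt0; apply/ler_addgt0Pr => e e_gt0.
pose de := Num.min e e0.
have de0 : 0 < de by rewrite lt_min e_gt0.
have [dee dee0] : de <= e /\ de <= e0 by rewrite !ge_min !lexx orbT.
have [h [Gh hxy]] := distM_lt G x y (e0 + de) ltac:(lra).
move: gxy hxy; rewrite !(hyp_distC _ y) => gxy hxy.
have := hyp_dist_ge0 y (hyp_act G g Gg x).
rewrite le_eqVlt => /predU1P[<-|r0]; first by lra.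
have [p [py pgx]] := hyp_geodesic_to _ _ r0.
suff -> : hyp_dist y (hyp_act G g Gg x) = hyp_dist y (hyp_act G h Gh x) by lra.
have [q [qy qhx]] : exists q : unithyp R d, hyp_foot q = y /\
    hyp_foot (hyp_flow (hyp_dist y (hyp_act G h Gh x)) q) = hyp_act G h Gh x.
  have := hyp_dist_ge0 y (hyp_act G h Gh x).
  rewrite le_eqVlt => /predU1P[s0|]; last exact: hyp_geodesic_to.
  (* If the second lift is [y] itself, any direction serves, in particular that of [p]. *)
  exists p; rewrite -s0 hyp_flow0 py; split=> //.
  apply/val_inj/hyperboloid_lform_eq; rewrite ?hypP//.
  by have := cosh_hyp_dist y (hyp_act G h Gh x); rewrite -s0 cosh0; lra.
have [|||||-> _ //] := inj (\pi_M y) (\pi_SM p) (\pi_SM q)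
  (hyp_dist y (hyp_act G g Gg x)) (hyp_dist y (hyp_act G h Gh x)).
- by rewrite foot_pi py.
- by rewrite foot_pi qy.
- by rewrite hyp_dist_ge0.
- by rewrite hyp_dist_ge0; lra.
- by rewrite !geod_pi pgx qhx !pi_act.
Qed.

(* The isometry matching the two lifts at time [0] also matches them at all later
   times, because the distance can only jump by less than the injectivity
   radius over a short time step. *)
Lemma common_lift_isometry (p q : unithyp R d) (l : R) : 0 <= l ->
  dist_upto l (\pi_SM p) (\pi_SM q) <= e0 ->
  exists g (Gg : isom_set G g), forall t : R, 0 <= t <= l ->
    hyp_dist (hyp_act G g Gg (hyp_foot (hyp_flow t p)))
      (hyp_foot (hyp_flow t q)) <= e0.
Proof.
move=> l0 pq.
have pqt (t : R) : 0 <= t <= l ->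
    distM (\pi_M (hyp_foot (hyp_flow t p))) (\pi_M (hyp_foot (hyp_flow t q))) <= e0.
  by move=> tl; rewrite -!geod_pi; apply: le_trans pq; exact: distM_le_dist_upto.
have e0p := e0_gt0; have e02 : e0 < 2 * e0 by lra.
have l00 : 0 <= (0 : R) <= l by rewrite lexx.
have [g [Gg g0]] := distM_lt G _ _ _ (le_lt_trans (pqt 0 l00) e02).
exists g, Gg.
(* In time [e0 / 3] the distance of the lifts grows from [e0] to at most [5 * e0 / 3 < 2 * e0], and
   [nearby_lift_dist] brings it back to [e0]. *)
suff step (k : nat) (t : R) : 0 <= t <= l -> t <= k%:R * (e0 / 3) ->
    hyp_dist (hyp_act G g Gg (hyp_foot (hyp_flow t p)))
      (hyp_foot (hyp_flow t q)) <= e0.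
  move=> t tl; apply: (step (Num.truncn (t / (e0 / 3))).+1 t tl).
  by rewrite -ler_pdivrMr ?divr_gt0// ltW// truncnS_gt.
elim: k t => [|k IH] t tl.
  rewrite mul0r => t0; have -> : t = 0 by lra.
  exact: (nearby_lift_dist _ _ _ _ (pqt 0 l00)).
rewrite -natr1 mulrDl mul1r => tk; apply: nearby_lift_dist; first exact: pqt.
pose t' := Num.max 0 (t - e0 / 3).
have [t'0 t'e] : 0 <= t' /\ t - e0 / 3 <= t' by rewrite !le_max !lexx orbT.
have t't : t' <= t by rewrite ge_max; apply/andP; split; lra.
have t'k : t' <= k%:R * (e0 / 3).
  by rewrite ge_max; apply/andP; split; [rewrite mulr_ge0// divr_ge0// ltW|lra].
have t'l : 0 <= t' <= l by lra.
have := IH t' t'l t'k.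
have := hyp_dist_flow p _ _ t't; have := hyp_dist_flow q _ _ t't.
have := hyp_dist_triangle (hyp_act G g Gg (hyp_foot (hyp_flow t' p)))
  (hyp_act G g Gg (hyp_foot (hyp_flow t p))) (hyp_foot (hyp_flow t q)).
have := hyp_dist_triangle (hyp_foot (hyp_flow t' q))
  (hyp_act G g Gg (hyp_foot (hyp_flow t' p))) (hyp_foot (hyp_flow t q)).
rewrite hyp_dist_act (hyp_distC (hyp_foot (hyp_flow t p))).
move: (hyp_dist _ _) (hyp_dist _ _) (hyp_dist _ _) (hyp_dist _ _) (hyp_dist _ _).
by move=> *; lra.
Qed.

(** The point [y] at distance [e0 / 2] from [x] towards [z] moves by at most [e0]. If it moved at
    all, it would yield a geodesic loop in the quotient too short for the injectivity radius; hence
    [g] fixes the direction towards [z]. *)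
Lemma isom_fixed_point g x (z : 'rV[R]_d.+1) : isom_set G g ->
  on_hyperboloid x -> on_hyperboloid z -> x *m g = x -> z *m g = z.
Proof.
move=> Gg xH zH xg; have e0p := e0_gt0; have [//|zg] := eqVneq (z *m g) z.
pose x' := Hyp xH; pose z' := Hyp zH.
have xz : 0 < hyp_dist x' z'.
  rewrite lt_neqAle hyp_dist_ge0 andbT; apply: contraNneq zg => xz0.
  have e : lform x z = -1.
    by have := cosh_hyp_dist x' z'; rewrite -xz0 cosh0 /=; lra.
  by rewrite -(hyperboloid_lform_eq _ _ xH zH e) xg.
have [p [px pz]] := hyp_geodesic_to _ _ xz.
have p1 : p.1 = x by have := congr1 val px; rewrite /= hyp_footE.
have p2 : p.2 *m g != p.2.
  apply: contraNneq zg => pg; have /= <- := congr1 val pz.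
  by rewrite mulmxDl -!scalemxAl pg p1 xg.
pose y := hyp_foot (hyp_flow (e0 / 2) p).
have e2 : 0 < e0 / 2 by rewrite divr_gt0.
have yE : hyp_val y = cosh (e0 / 2) *: x + sinh (e0 / 2) *: p.2.
  by rewrite /y hyp_footE /= p1.
have xy : hyp_dist x' y = e0 / 2.
  have := hyp_dist_flow p _ _ (ltW e2); rewrite hyp_flow0 px subr0 => h; exact: h.
have gx : hyp_act G g Gg x' = x' by apply: val_inj.
have yg : hyp_dist y (hyp_act G g Gg y) <= e0.
  apply: (le_trans (hyp_dist_triangle x' _ _)); rewrite -{2}gx hyp_dist_act.
  by rewrite (hyp_distC y) xy; lra.
have y0 : 0 < hyp_dist y (hyp_act G g Gg y).
  rewrite lt_neqAle hyp_dist_ge0 andbT; apply: contraNneq p2 => y0.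
  have e : lform y (hyp_act G g Gg y) = -1.
    by have := cosh_hyp_dist y (hyp_act G g Gg y); rewrite -y0 cosh0; lra.
  have := hyperboloid_lform_eq _ _ (hypP _) (hypP _) e.
  rewrite -[hyp_val (hyp_act _ _ _ _)]/(hyp_val y *m g) yE mulmxDl -!scalemxAl xg => /addrI.
  by move=> /(scalerI (lt0r_neq0 (sinh_gt0 _ e2)))/esym/eqP.
have [q [qy qyg]] := hyp_geodesic_to _ _ y0.
have [|||||e _] := inj (\pi_M y) (\pi_SM q) (\pi_SM q) (hyp_dist y (hyp_act G g Gg y)) 0.
- by rewrite foot_pi qy.
- by rewrite foot_pi qy.
- by rewrite hyp_dist_ge0/=; lra.
- by rewrite lexx /=; lra.
- by rewrite !geod_pi qyg hyp_flow0 qy pi_act.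
by move: y0; rewrite e ltxx.
Qed.

Lemma isom_axis g (z : 'rV[R]_d.+1) : cocompact_lattice G -> isom_set G g ->
  on_hyperboloid z -> z *m g != z -> exists y w tau,
  [/\ 0 < tau, unit_tangent y w, y *m g = cosh tau *: y + sinh tau *: w &
    w *m g = sinh tau *: y + cosh tau *: w].
Proof.
move=> GL Gg zH zg; have [x xH xmin] := min_displacement G GL g Gg.
exists x; apply: axis_of_min_displacement => //; first exact: (isom_group_sub Gg).
apply: contraNneq zg => e; apply/eqP/(isom_fixed_point g x) => //.
by apply/esym/hyperboloid_lform_eq => //; exact: (isom_hyperboloid G).
Qed.

Lemma hyp_flow_act g (Gg : isom_set G g) t (p : unithyp R d) :
  hyp_flow t (unithyp_act G g Gg p) = unithyp_act G g Gg (hyp_flow t p).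
Proof. by apply: val_inj; rewrite /= !mulmxDl -!scalemxAl. Qed.

End ClosedManifold.

(** * From axes to closed geodesics and penetration lengths *)

Section AxisGeodesic.
Context {R : realType} {d : nat} (G : isom_group R d).
Local Open Scope quotient_scope.
Local Notation M := (qman G).
Local Notation SM := (unitM G).

(** Flowing by [tau] along the axis is the action of [g], trivial in the quotient. The parameter [t]
    leaves the starting point on the axis free. *)
Lemma axis_closed g (q : unithyp R d) tau t : isom_set G g ->
  q.1 *m g = cosh tau *: q.1 + sinh tau *: q.2 ->
  q.2 *m g = sinh tau *: q.1 + cosh tau *: q.2 ->
  flow tau (\pi_SM (hyp_flow t q)) = \pi_SM (hyp_flow t q).
Proof.
move=> Gg q1 q2; rewrite flow_pi hyp_flowD addrC -hyp_flowD.
have -> : hyp_flow tau q = unithyp_act G g Gg q.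
  by apply: val_inj; rewrite /= q1 q2.
rewrite hyp_flow_act; apply/esym/unitMP; by exists g, Gg.
Qed.

Lemma penetration_ge e0 (a : closed_geodesic G) (v : SM) t0 L : 0 <= L ->
  0 <= e0 -> dist_upto L (flow t0 v) (cg_dir a) <= e0 / 2 ->
  (L%:E <= penetration e0 a v t0)%E.
Proof.
move=> L0 e00 h.
have f0 : flow 0 (cg_dir a) = cg_dir a.
  by have [p ->] := unitM_pi G (cg_dir a); rewrite flow_pi hyp_flow0.
have L00 : 0 <= (0 : R) <= L by rewrite lexx.
have h0 := le_trans (distM_le_dist_upto G L _ _ 0 L00) h.
rewrite geod_flow addr0 in h0.
(* Closeness at time 0 excludes the branch in which the penetration length is 0. *)
rewrite /penetration ifF; last first.
  apply/negbTE; rewrite -leNgt; apply: le_trans h0; apply: ge_inf.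
    by exists 0 => _ [q _ <-]; exact: distM_ge0.
  by exists (geod (cg_dir a) 0) => //; exists 0.
apply: ereal_sup_ubound; exists L => //; split=> //; exists 0; last by rewrite f0.
by rewrite lexx ltW// cg_len_gt0.
Qed.

End AxisGeodesic.

Lemma bounded_aperiodic (R : realType) (d : nat) (G : isom_group R d) (e0 : R) :
  cocompact_lattice G -> 0 < e0 ->
  (forall p, exp_injective (G := G) p (2 * e0)) ->
  exists2 c0 : R, 0 < c0 &
    forall (o : qman G) (v : unitM G) (phi : R -> R),
      increasing_invertible e0 phi ->
      bounded_all e0 o phi v ->
      exists l0 s0 : R,
        [/\ 2 * c0 + 2 * e0 + 1 < l0, e0 < s0 &
          forall t0 s l : R, 0 <= t0 -> s0 <= s -> l0 <= l ->
            dist_upto l (flow t0 v) (flow (t0 + s) v) <= e0 ->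
            phi (l - 2 * c0 - 2 * e0) - e0 <= s].
Proof.
move=> GL e0_gt0 inj; have [c0 [T0 [c0_gt0 T0_gt0 travel]]] := fellow_travel e0 e0_gt0.
exists c0 => // o v phi phiI bnd.
(* [T0] makes [fellow_travel] applicable, and the remaining terms keep the argument of [phi] above
   1. *)
exists (T0 + 2 * c0 + 2 * e0 + 2), (T0 + e0); split; [lra|lra|].
move=> t0 s l t00 s0s l0l vv.
have [Ts Tl es ll] : [/\ T0 <= s, T0 <= l, e0 < s & 2 * c0 + 2 * e0 + 1 < l].
  by split; lra.
have [p vE] := unitM_pi G (flow t0 v).
have l_ge0 : 0 <= l by lra.
have [g [Gg close]] : exists g (Gg : isom_set G g), forall t : R, 0 <= t <= l ->
    hyp_dist (hyp_act G g Gg (hyp_foot (hyp_flow t p)))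
      (hyp_foot (hyp_flow (s + t) p)) <= e0.
  have vv' := vv; rewrite -flowD vE flow_pi in vv'.
  have [g [Gg h]] := common_lift_isometry G e0 e0_gt0 inj _ _ _ l_ge0 vv'.
  by exists g, Gg => t tl; have := h t tl; rewrite hyp_flowD.
have pu := unithypP p; have pH : on_hyperboloid p.1 by case/unit_tangentP: pu.
have zero_l : 0 <= (0 : R) <= l by rewrite lexx.
have l_l : 0 <= l <= l by rewrite lexx andbT.
have close0 := close 0 zero_l; have closel := close l l_l.
rewrite hyp_flow0 addr0 in close0.
(* Otherwise the points of the lifted geodesic at times 0 and [s] would be [e0]-close, although
   their distance is [s > e0]. *)
have moved : p.1 *m g != p.1.
  apply/eqP => pg; have : hyp_act G g Gg (hyp_foot p) = hyp_foot p.
    by apply: val_inj; rewrite /= hyp_footE.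
  move=> e; move: close0; rewrite e.
  have s_ge0 : 0 <= s by lra.
  by have := hyp_dist_flow p _ _ s_ge0; rewrite hyp_flow0 => ->; lra.
have [y [w [tau [tau0 yw yg wg]]]] := isom_axis G e0 e0_gt0 inj g _ GL Gg pH moved.
pose q : unithyp R d := UnitHyp (unithyp_val := (y, w)) yw.
rewrite (hyp_dist_le _ _ _ (ltW e0_gt0)) /= ?hyp_footE in close0.
rewrite (hyp_dist_le _ _ _ (ltW e0_gt0)) /= ?hyp_footE in closel.
have [tau_le [r near]] := travel d p.1 p.2 y w g tau s l pu yw
  (isom_group_sub Gg) (ltW tau0) yg wg Ts Tl close0 closel.
(* It starts at the parameter [c0 + r] of the axis, which corresponds to the time [t0 + c0] of the
   ray. *)
pose a := ClosedGeodesic tau0 (axis_closed G g q tau (c0 + r) Gg yg wg).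
have L0 : 0 <= s + l - 2 * c0 by lra.
have pen : ((s + l - 2 * c0)%:E <= penetration e0 a v (t0 + c0))%E.
  apply: penetration_ge => //; first exact: ltW.
  apply: dist_upto_le => // t /andP[tge0 tL].
  rewrite -flowD vE flow_pi !geod_pi !hyp_flowD.
  apply: (le_trans (distM_le _ _ _)); rewrite hyp_dist_le.
    2: by apply: divr_ge0 => //; exact: ltW.
  rewrite /= (addrAC c0 r).
  by apply: near; apply/andP; split; lra.
have [_ /(_ (t0 + c0) ltac:(lra)) pen'] := bnd a I.
have := le_trans pen pen'; rewrite lee_fin /= => L_le.
have tau_ge := closed_geodesic_length_ge G _ a inj; rewrite /= in tau_ge.
have e0tau : e0 < tau by lra.
have [inv1 phiK] := phi_invP _ _ _ _ phiI e0tau.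
(* From [s + l - 2 * c0 <= tau + phi_inv phi tau] and [tau <= s + e0] one gets
   [l - 2 * c0 - e0 <= phi_inv phi tau]; the second [e0] makes the inequality strict. *)
have : phi (l - 2 * c0 - 2 * e0) < phi (phi_inv phi tau).
  by apply: (proj2 phiI) => //; rewrite ?in_itv/= ?andbT; lra.
by rewrite phiK; lra.
Qed.

Theorem theorem3p14 (R : realType) (n : nat) (G : isom_group R n.+1) (e0 : R)
  (n_gt0 : (0 < n)%N)
  (G_torsion_free : torsion_free G) (G_cocompact : cocompact_lattice G)
  (e0_gt0 : 0 < e0) (e0_inj : ((2 * e0)%:E < inj_radius G)%E) :
  (forall (o : qman G) (v : unitM G) (phi : R -> R),
      foot v = o -> increasing_invertible e0 phi ->
      aperiodic `]1, +oo[%classic phi e0 0 v ->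
      bounded_all e0 o phi v)
  /\
  (((2 * ln (1 + Num.sqrt 2))%:E <= inj_radius G)%E ->
    exists2 c0 : R, 0 < c0 &
    forall (o : qman G) (v : unitM G) (phi : R -> R),
      foot v = o -> increasing_invertible e0 phi ->
      bounded_all e0 o phi v ->
      exists l0 s0 : R,
        [/\ 2 * c0 + 2 * e0 + 1 < l0, e0 < s0 &
          forall t0 s l : R, 0 <= t0 -> s0 <= s -> l0 <= l ->
            dist_upto l (flow t0 v) (flow (t0 + s) v) <= e0 ->
            phi (l - 2 * c0 - 2 * e0) - e0 <= s]).
Proof.
have inj p : exp_injective (G := G) p (2 * e0) by exact: inj_radius_exp_injective.
split; [by move=> o v phi; exact: aperiodic_bounded|move=> _].
have [c0 c0_gt0 h] := bounded_aperiodic R n.+1 G e0 G_cocompact e0_gt0 inj.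
by exists c0 => // o v phi _; exact: h.
Qed.
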